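(* Let $G=(V,E)$ be an undirected graph with $V=\{1,\dots,n\}$ and root node $1$. Suppose the signals $\{x_v^\star\}_{v\in V}\subset\mathbb{R}^d$ are $(G,s,s')$-sparse and the matrices satisfy $A_v=\frac{1}{\sqrt{N_v}}\widetilde A_v\in\mathbb{R}^{N_v\times d}$, where $\{\widetilde A_v\}_{v\in V}$ each have i.i.d. sub-Gaussian entries. Let $y_v=A_vx_v^\star$ for $v\in V$, let $N_{\text{Root}}=N_1$, and let all non-root nodes have the same sample size $N_v=N_{\text{Non-root}}$, $v\in V\setminus\{1\}$. Fix $\epsilon>0$. If $$N_{\text{Root}}\ \gtrsim\ \max\{s,\ n^2\,\mathrm{Diam}(G)\,s'\}\big(\log(d)+\log(1/\epsilon)\big)$$ and $$N_{\text{Non-root}}\ \gtrsim\ n\,\mathrm{Diam}(G)\,s'\big(\log(d)+\log(n/\epsilon)\big),$$ then with probability greater than $1-\epsilon$ the solution $\{x_v^{TVBP}\}_{v\in V}$ of the Total Variation Basis Pursuit problem with a star graph $\widetilde G$ is unique and satisfies $x_v^{TVBP}=x_v^\star$ for any $v\in V$.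
   Context: Sparsity: $\mathrm{Supp}(x)$ is the set of indices of nonzero coordinates of $x$. A collection $\{x_v^\star\}_{v\in V}\subset\mathbb{R}^d$ is $(G,s,s')$-sparse if $|\mathrm{Supp}(x_1^\star)|\le s$ (node $1$ is the root) and $|\mathrm{Supp}(x_v^\star-x_w^\star)|\le s'$ for every edge $(v,w)\in E$. Sub-Gaussian entries: a random matrix $A$ has i.i.d. sub-Gaussian entries if its entries are independent and identically distributed and $\mathbb{P}(|A_{ij}|\ge t)\le\beta e^{-\kappa t^2}$ for all $t\ge0$, for sub-Gaussian parameters $\beta$ and $\kappa$. Total Variation Basis Pursuit (TVBP): given a tree graph $\widetilde G=(V,\widetilde E)$, matrices $A_v$ and responses $y_v$, it is the optimisation problem $$\min_{x_1,\dots,x_n}\ \|x_1\|_1+\sum_{e=(v,w)\in\widetilde E}\|x_v-x_w\|_1\quad\text{subject to}\quad A_vx_v=y_v\ \text{ for } v\in V,$$ and a solution is denoted $\{x_v^{TVBP}\}_{v\in V}$. The graph $\widetilde G$ need not equal $G$. $\mathrm{Diam}(G)$ is the graph diameter of $G$. The symbol $\gtrsim$ means $\ge$ up to a multiplicative constant depending only on the sub-Gaussian parameters $\beta,\kappa$.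
   Formalization: The sub-Gaussian entries are additionally assumed to have mean 0 and variance 1, and the matrices at different nodes to be independent; with the tail bound alone zero matrices are allowed and recovery fails. G is taken connected, with d and all sample sizes at least 1. *)

(* Defs.v *)
(* MathComp + MathComp-Analysis. *)
From mathcomp Require Import all_boot all_order all_algebra.
From mathcomp Require Import all_classical all_reals all_analysis.

Set Implicit Arguments.
Unset Strict Implicit.
Unset Printing Implicit Defensive.

Import Order.TTheory GRing.Theory Num.Theory.
Local Open Scope classical_set_scope.
Local Open Scope ring_scope.

(* An undirected graph on a finite type is given by its symmetric adjacency
   relation e. *)
Section Graph.
Variables (V : finType) (e : rel V).

(* Number of edges of a shortest walk from v to w.  A shortest walk has fewer
   than #|V| edges; the (unused) value when w is unreachable is #|V|. *)
Definition gdist (v w : V) : nat :=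
  find (fun k => [exists p : k.-tuple V, path e v p && (last v p == w)])
       (iota 0 #|V|).

Definition diam : nat := \max_(v : V) \max_(w : V) gdist v w.

Definition connected_graph : Prop := forall v w : V, connect e v w.

Definition star (r : V) : rel V :=
  fun v w => (v != w) && ((v == r) || (w == r)).

End Graph.

Section Signals.
Variables (R : realType) (n d : nat).

Definition Supp (x : 'cV[R]_d) : {set 'I_d} := [set i | x i 0 != 0]%SET.

Definition sparse_signals (root : 'I_n) (e : rel 'I_n) (s s' : nat)
    (x : 'I_n -> 'cV[R]_d) : Prop :=
  (#|Supp (x root)| <= s)%N /\
  forall v w, e v w -> (#|Supp (x v - x w)| <= s')%N.

Definition l1norm (x : 'cV[R]_d) : R := \sum_(i < d) `|x i 0|.

(* The edge {v, w} is enumerated once, as the pair with v < w. *)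
Definition tv_objective (root : 'I_n) (e : rel 'I_n)
    (x : 'I_n -> 'cV[R]_d) : R :=
  l1norm (x root) +
  \sum_(p : 'I_n * 'I_n | (p.1 < p.2)%N && e p.1 p.2) l1norm (x p.1 - x p.2).

Variable N : 'I_n -> nat.

Definition tvbp_feasible (A : forall v, 'M[R]_(N v, d))
    (y : forall v, 'cV[R]_(N v)) (x : 'I_n -> 'cV[R]_d) : Prop :=
  forall v, A v *m x v = y v.

Definition tvbp_solution (root : 'I_n) (e : rel 'I_n)
    (A : forall v, 'M[R]_(N v, d)) (y : forall v, 'cV[R]_(N v))
    (x : 'I_n -> 'cV[R]_d) : Prop :=
  tvbp_feasible A y x /\
  forall x', tvbp_feasible A y x' ->
    tv_objective root e x <= tv_objective root e x'.

End Signals.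

Section Random.
Context {dT : measure_display} {T : measurableType dT} {R : realType}.
Variable P : probability T R.

Definition mutually_independent (I : finType) (X : I -> {RV P >-> R}) : Prop :=
  forall (J : {set I}) (B : I -> set R), (forall i, measurable (B i)) ->
    P [set t | forall i, i \in J -> B i (X i t)] =
    (\prod_(i in J) P (X i @^-1` B i))%E.

Definition identically_distributed (I : Type) (X : I -> {RV P >-> R}) : Prop :=
  forall (i j : I) (B : set R), measurable B ->
    distribution P (X i) B = distribution P (X j) B.

(* The entries are standardized (mean 0, variance 1), as is usual for
   sub-Gaussian random matrices: the tail bound alone would also allow
   identically zero matrices. *)
Definition iid_subgaussian (beta kappa : R) (m d : nat)
    (A : 'I_m -> 'I_d -> {RV P >-> R}) : Prop :=
  [/\ mutually_independent (fun ij : 'I_m * 'I_d => A ij.1 ij.2),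
      identically_distributed (fun ij : 'I_m * 'I_d => A ij.1 ij.2),
      forall i j, ('E_P[A i j] = 0 /\ 'V_P[A i j] = 1)%E &
      forall i j (t : R), 0 <= t ->
        (P [set w | (t <= `|A i j w|)%R]
           <= (beta * expR (- kappa * t ^+ 2))%:E)%E].

(* For matrices with independent entries, joint independence of all the entries
   amounts to independence of the matrices. *)
Definition independent_matrices (n d : nat) (N : 'I_n -> nat)
    (A : forall v, 'I_(N v) -> 'I_d -> {RV P >-> R}) : Prop :=
  mutually_independent
    (fun k : {v : 'I_n & ('I_(N v) * 'I_d)%type} =>
       A (tag k) (tagged k).1 (tagged k).2).

Definition normalized_matrix (m d : nat) (A : 'I_m -> 'I_d -> {RV P >-> R})
    (w : T) : 'M[R]_(m, d) :=
  (Num.sqrt m%:R)^-1 *: \matrix_(i < m, j < d) A i j w.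

End Random.

(* Main.v *)
(** Write [u] for the error at the root and [g_v = h_v - u] for the errors on the
edges of the star, where [h_v] lies in the kernel of [A_v].

Deterministic part.  Each relative signal [x_v - x_root] is [Diam(G) s']-sparse.
If the part of [g_v] on this support dominates, then [A_v] is bounded below at
[g_v], and [A_v g_v = - A_v u].  Summing [|A_v u|_2] over [v] by Cauchy-Schwarz
brings in the matrix stacking all non-root rows: it has about [n N_Non-root] rows
and hence acts boundedly at sparsity level [n^2 Diam(G) s'], which is what makes
[n Diam(G) s'] samples per node sufficient.

Probabilistic part.  All that is needed are bounds of the form
[|A x|_2^2 >= c |x|_2^2 - C |x|_1^2 / k] and [|A x|_2^2 <= C (|x|_2^2 + |x|_1^2 / k)],
uniformly in [x].  Maurey's empirical method approximates any [x] by a multiple of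
a signed sum of [k] coordinate vectors, simultaneously in [|.|_2] and in [|A .|_2],
so that a union bound over the [(2d)^k] signed sums replaces epsilon-nets. *)
Require Import Defs.
From HB Require Import structures.
From mathcomp Require Import all_boot all_order all_algebra.
From mathcomp Require Import all_classical all_reals all_analysis.
From mathcomp Require Import measurable_realfun.
From mathcomp Require Import ring lra.

Set Implicit Arguments.
Unset Strict Implicit.
Unset Printing Implicit Defensive.

Import Order.TTheory GRing.Theory Num.Theory.
Local Open Scope classical_set_scope.
Local Open Scope ring_scope.

(** * Independence *)

(** The correction [l1norm x ^+ 2 / k] makes the energy bounds valid for every vector, so kernel
    vectors need no decomposition into sparse blocks: once the mass of [x] on a small support
    dominates, Cauchy-Schwarz absorbs the correction into [sqnorm x]. The level [k] is a free
    parameter, always [M0] times a sparsity: [s2 = diam e * s'] for one node, [n ^ 2 * s2] for the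
    stacked rows, [maxn s (n ^ 2 * s2)] for the root.

    The constants are shaped by the strict inequality in the conclusion. The failure probability
    must lie below [eps], and [eps = 1] is allowed; if moreover [d = 1], the root hypothesis says
    nothing beyond the presence of one row, and a union bound with any fixed prefactor could exceed
    1. Hence dimension one is treated with a single direction and a one-sided tail. The root event
    gets the share [eps * expR (- (c0 / 2))], which a single row can pay for, and all other events
    together get [eps * expR (- margin)], where the two factors sum to less than 1. *)

Section Independence.
Context {dT : measure_display} {T : measurableType dT} {R : realType}.
Variables (P : probability T R) (I : finType) (X : I -> {RV P >-> R}).
Hypothesis indepX : mutually_independent X.

(** A pi-system, since intersections are taken coordinate by coordinate; it generates the
    sigma-algebra of the coordinates in [J]. *)
Definition cylinder (J : {set I}) : set (set T) :=
  [set A | exists2 B : I -> set R, (forall i, measurable (B i)) &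
     A = [set t | forall i, i \in J -> B i (X i t)]].

(** Retyping the domain with the generated sigma-algebra turns measurability for a sub-sigma-algebra
    into an ordinary [measurable_fun], so closure under sums, products and composition applies
    unchanged. *)
Definition measurable_wrt d' (T' : measurableType d') (J : {set I})
    (f : T -> T') : Prop :=
  measurable_fun [set: g_sigma_algebraType (cylinder J)]
    (f : g_sigma_algebraType (cylinder J) -> T').

Lemma cylinder_measurable (J : {set I}) : cylinder J `<=` measurable.
Proof.
move=> _ [B mB ->].
rewrite [X in measurable X](_ : _ =
    \bigcap_(i in [set` J]) (X i @^-1` B i)); last by apply/seteqP; split.
apply: fin_bigcap_measurable => // i _.
by rewrite -[X in measurable X]setTI; exact: measurable_funP.
Qed.

Lemma cylinder_setI_closed (J : {set I}) : setI_closed (cylinder J).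
Proof.
move=> _ _ [B mB ->] [C mC ->]; exists (fun i => B i `&` C i).
  by move=> i; exact: measurableI.
apply/seteqP; split => t /= => [[tB tC] i iJ|tBC]; first by split; auto.
by split=> i /tBC[].
Qed.

Lemma cylinderT (J : {set I}) : cylinder J [set: T].
Proof. by exists (fun=> setT) => //; apply/seteqP; split. Qed.

Lemma cylinderS (J K : {set I}) : J \subset K -> cylinder J `<=` cylinder K.
Proof.
move=> sJK _ [B mB ->]; exists (fun i => if i \in J then B i else setT).
  by move=> i; case: ifP.
apply/seteqP; split => t /= tB i iJ; first by case: ifP => // /tB.
by have := tB i; rewrite iJ; apply; exact: (fintype.subsetP sJK).
Qed.

Lemma cylinder_indep (J K : {set I}) (A B : set T) : [disjoint J & K]%bool ->
  cylinder J A -> cylinder K B -> (P (A `&` B) = P A * P B)%E.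
Proof.
move=> JK [C mC ->] [D mD ->].
have JKF i : i \in K -> (i \in J) = false by move=> iK; rewrite (disjointFl JK).
(* Disjointness merges the two families of constraints into one, to which independence over the
   union applies. *)
pose F i := if i \in J then C i else D i.
have mF i : measurable (F i) by rewrite /F; case: ifP.
rewrite !indepX//.
have -> : [set t | forall i, i \in J -> C i (X i t)] `&`
    [set t | forall i, i \in K -> D i (X i t)] =
    [set t | forall i, i \in J :|: K -> F i (X i t)].
  apply/seteqP; split => t /= => [[tC tD] i|tF].
    by rewrite inE /F; case: ifPn => [/tC//|_ /=]; exact: tD.
  split=> i ijk; have := tF i; rewrite inE ijk ?orbT /F ?ijk ?JKF//; exact.
rewrite indepX// (eq_bigl [in [predU J & K]]) => [|i]; last by rewrite !inE.
rewrite bigU//=.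
congr (_ * _)%E; apply: eq_bigr => i; rewrite /F; first by move=> ->.
by move=> iK; rewrite JKF.
Qed.

(** As functions of [E], both sides are finite measures: [P] restricted to [A], and [P] scaled by
    [P A]. They agree on a pi-system, hence on the sigma-algebra it generates. *)
Lemma indep_sigma_algebra (G : set (set T)) (A : set T) :
  measurable A -> G `<=` measurable -> G setT -> setI_closed G ->
  (forall E, G E -> P (E `&` A) = P E * P A)%E ->
  forall E, <<s G >> E -> (P (E `&` A) = P E * P A)%E.
Proof.
move=> mA mG GT GI GA E sE.
have PA0 : 0 <= fine (P A) by apply: fine_ge0.
have PAE : P A = (fine (P A))%:E by rewrite fineK// fin_num_measure.
rewrite [RHS]muleC PAE.
apply: (g_sigma_algebra_measure_unique G mG (fun=> setT) _ _
  (mrestr P mA) (mscale (NngNum PA0) P)) => //.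
- by apply/seteqP; split => // x _; exists 0%N.
- by move=> B GB; rewrite /= /mrestr /mscale/= GA// muleC PAE.
- move=> _; rewrite /= /mrestr setTI; apply: le_lt_trans (ltry 1).
  exact: probability_le1.
Qed.

Lemma sigma_cylinder_measurable (J : {set I}) :
  <<s cylinder J >> `<=` measurable.
Proof.
apply: smallest_sub; first exact: sigma_algebra_measurable.
exact: cylinder_measurable.
Qed.

(** The passage from generators to sigma-algebras is made in one argument at a time. *)
Lemma sigma_cylinder_indep (J K : {set I}) (A B : set T) : [disjoint J & K]%bool ->
  <<s cylinder J >> A -> <<s cylinder K >> B -> (P (A `&` B) = P A * P B)%E.
Proof.
move=> JK sA sB; apply: (@indep_sigma_algebra (cylinder J)) => //.
- exact: sigma_cylinder_measurable sB.
- exact: cylinder_measurable.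
- exact: cylinderT.
- exact: cylinder_setI_closed.
move=> E cE; rewrite setIC muleC; apply: (@indep_sigma_algebra (cylinder K)) => //.
- exact: cylinder_measurable cE.
- exact: cylinder_measurable.
- exact: cylinderT.
- exact: cylinder_setI_closed.
by move=> F cF; rewrite setIC muleC (cylinder_indep JK).
Qed.

Lemma measurable_wrtT d' (T' : measurableType d') (J : {set I}) (f : T -> T') :
  measurable_wrt J f -> measurable_fun setT f.
Proof. by move=> mf _ B mB; apply: sigma_cylinder_measurable; exact: mf. Qed.

Lemma measurable_wrtS d' (T' : measurableType d') (J K : {set I})
    (f : T -> T') :
  J \subset K -> measurable_wrt J f -> measurable_wrt K f.
Proof.
move=> sJK mf _ B mB; have := mf measurableT B mB.
by apply: sub_smallest2r; [exact: smallest_sigma_algebra|exact: cylinderS].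
Qed.

Lemma measurable_wrt_coord (J : {set I}) (i : I) :
  i \in J -> measurable_wrt J (X i).
Proof.
move=> iJ _ B mB; rewrite setTI; apply: sub_sigma_algebra.
exists (fun k => if k == i then B else setT); first by move=> k; case: ifP.
apply/seteqP; split => t /= => [tB k _|/(_ i iJ)]; last by rewrite eqxx.
by case: eqP => // ->.
Qed.

(** The joint law of [U] and [V] agrees with the product of their laws on rectangles, hence
    everywhere, and Tonelli applies. The inner integral amounts to replacing [V] by an independent
    copy. *)
Lemma ge0_integral_indep d1 d2 (T1 : measurableType d1) (T2 : measurableType d2)
    (J K : {set I}) (U : T -> T1) (V : T -> T2) (f : T1 * T2 -> \bar R) :
  [disjoint J & K]%bool -> measurable_wrt J U -> measurable_wrt K V ->
  measurable_fun setT f -> (forall x, 0 <= f x)%E ->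
  (\int[P]_w f (U w, V w) = \int[P]_w \int[P]_w' f (U w, V w'))%E.
Proof.
move=> JK mU mV mf f0.
have mU' := measurable_wrtT mU; have mV' := measurable_wrtT mV.
pose U' : {RV P >-> T1} := HB.pack U (isMeasurableFun.Build _ _ _ _ _ mU').
pose V' : {RV P >-> T2} := HB.pack V (isMeasurableFun.Build _ _ _ _ _ mV').
have mUV : measurable_fun setT (fun w => (U w, V w)).
  exact: measurable_fun_pair.
pose W' : {RV P >-> (T1 * T2)%type} :=
  HB.pack (fun w => (U w, V w)) (isMeasurableFun.Build _ _ _ _ _ mUV).
have lawE E : measurable E ->
    (distribution P U' \x distribution P V')%E E = distribution P W' E.
  apply: product_measure_unique => A B mA mB.
  change (P ((U @^-1` A) `&` (V @^-1` B)) = P (U @^-1` A) * P (V @^-1` B))%E.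
  apply: (sigma_cylinder_indep JK).
    by rewrite -[X in <<s _ >> X]setTI; exact: mU.
  by rewrite -[X in <<s _ >> X]setTI; exact: mV.
have -> : (\int[P]_w f (U w, V w) = \int[distribution P W']_z f z)%E.
  by rewrite ge0_integral_distribution.
rewrite (eq_measure_integral (distribution P U' \x distribution P V')%E);
  last by move=> A mA _; exact/esym/lawE.
rewrite fubini_tonelli1//= ge0_integral_distribution//=; last 2 first.
- exact: measurable_fun_fubini_tonelli_F.
- by move=> x; apply: integral_ge0.
apply: eq_integral => w _ /=; rewrite /fubini_F ge0_integral_distribution//.
by apply: measurableT_comp => //; exact: measurable_fun_pair.
Qed.

End Independence.

Section IndependentProducts.
Context {dT : measure_display} {T : measurableType dT} {R : realType}.
Variables (P : probability T R) (I : finType) (X : I -> {RV P >-> R}).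
Hypothesis indepX : mutually_independent X.

Lemma integral_mul_indep_le (J K : {set I}) (U V : T -> R) (a b : R) :
  [disjoint J & K]%bool -> measurable_wrt X J U -> measurable_wrt X K V ->
  (forall w, 0 <= U w) -> (forall w, 0 <= V w) -> 0 <= b ->
  (\int[P]_w (U w)%:E <= a%:E)%E -> (\int[P]_w (V w)%:E <= b%:E)%E ->
  (\int[P]_w (U w * V w)%:E <= (a * b)%:E)%E.
Proof.
move=> JK mU mV U0 V0 b0 Ua Vb.
have mU' : measurable_fun setT (EFin \o U).
  by apply/measurable_EFinP; exact: measurable_wrtT mU.
have mV' : measurable_fun setT (EFin \o V).
  by apply/measurable_EFinP; exact: measurable_wrtT mV.
(* The absolute value makes [f] nonnegative on the whole plane; it changes nothing on the values of
   [U] and [V]. *)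
pose f (x : R * R) : \bar R := `|x.1 * x.2|%:E.
have f0 x : (0 <= f x)%E by rewrite lee_fin.
have mf : measurable_fun setT f.
  apply/measurable_EFinP/measurableT_comp => //.
  by apply: measurable_funM; [exact: measurable_fst|exact: measurable_snd].
under eq_integral do rewrite -[X in X%:E]ger0_norm ?mulr_ge0//.
rewrite -[leLHS]/(\int[P]_w f (U w, V w))%E (ge0_integral_indep indepX JK mU mV mf f0).
apply: (@le_trans _ _ (\int[P]_w ((U w)%:E * b%:E))%E).
  apply: ge0_le_integral => //.
  - by move=> w _; apply: integral_ge0 => ? _; rewrite lee_fin.
  - have mU2 := measurable_wrtT mU; have mV2 := measurable_wrtT mV.
    pose V' : {RV P >-> R} := HB.pack V (isMeasurableFun.Build _ _ _ _ _ mV2).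
    apply: (eq_measurable_fun (fubini_F (distribution P V') f \o U)) => [w _|].
      rewrite /= /fubini_F ge0_integral_distribution//.
      by apply: measurableT_comp => //; exact: measurable_fun_pair.
    have mF := @measurable_fun_fubini_tonelli_F _ _ _ _ _
      (distribution P V') f mf f0.
    exact: (measurableT_comp mF mU2).
  - exact: emeasurable_funM.
  - move=> w _; rewrite /f /=.
    under eq_integral do rewrite ger0_norm ?mulr_ge0// EFinM.
    rewrite ge0_integralZl ?lee_fin//; last by move=> ? _; rewrite lee_fin.
    by rewrite lee_pmul// ?lee_fin//; apply: integral_ge0 => ? _; rewrite lee_fin.
rewrite ge0_integralZr ?lee_fin//; last by move=> ? _; rewrite lee_fin.
by rewrite EFinM lee_pmul// ?lee_fin//; apply: integral_ge0 => ? _; rewrite lee_fin.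
Qed.

Lemma measurable_wrt_comp d1 d2 (T1 : measurableType d1) (T2 : measurableType d2)
    (J : {set I}) (g : T1 -> T2) (f : T -> T1) :
  measurable_fun setT g -> measurable_wrt X J f -> measurable_wrt X J (g \o f).
Proof. by move=> mg mf; exact: measurableT_comp. Qed.

(** The product over the rest of the list is measurable for the union of its index sets, still
    disjoint from that of the head, so the two-factor case iterates. *)
Lemma integral_prod_indep_le (S : eqType) (rs : seq S) (J : S -> {set I})
    (U : S -> T -> R) (c : S -> R) :
  uniq rs -> (forall r r', r != r' -> [disjoint J r & J r']%bool) ->
  (forall r, measurable_wrt X (J r) (U r)) -> (forall r w, 0 <= U r w) ->
  (forall r, \int[P]_w (U r w)%:E <= (c r)%:E)%E ->
  (\int[P]_w (\prod_(r <- rs) U r w)%:E <= (\prod_(r <- rs) c r)%:E)%E.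
Proof.
move=> urs dJ mU U0 Uc.
have c0 r : 0 <= c r.
  rewrite -lee_fin; apply: le_trans (Uc r).
  by apply: integral_ge0 => w _; rewrite lee_fin.
elim: rs urs => [_|r rs ih /= /andP[rrs urs]].
  under eq_integral do rewrite big_nil.
  by rewrite integral_cst//= big_nil probability_setT mule1.
under eq_integral do rewrite big_cons.
rewrite big_cons; apply: (@integral_mul_indep_le (J r) (\bigcup_(r' <- rs) J r')%SET).
- rewrite -finset.setI_eq0 big_distrr /= big1_seq//= => r' r'rs.
  apply/eqP; rewrite finset.setI_eq0 dJ//.
  by apply: contraNneq rrs => ->.
- exact: mU.
- apply: measurable_prod => r' r'rs; apply: (measurable_wrtS _ (mU r')).
  by rewrite (bigD1_seq r')//= finset.subsetUl.
- exact: U0.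
- by move=> w; apply: prodr_ge0.
- exact: prodr_ge0.
- exact: Uc.
- exact: ih.
Qed.

End IndependentProducts.

(** * Exponential square moments from tail bounds *)

Section SubGaussianTails.
Context {dT : measure_display} {T : measurableType dT} {R : realType}.
Variable (P : probability T R).

Definition expsqr_bound (beta kappa : R) : R :=
  beta * expR (kappa / 2) / (1 - expR (- (kappa / 2))).

Lemma geometric_sum_le (q : R) n : 0 <= q < 1 ->
  \sum_(0 <= k < n) q ^+ k <= (1 - q)^-1.
Proof.
move=> /andP[q0 q1]; rewrite -[leRHS]mul1r ler_pdivlMr ?subr_gt0// mulrC.
rewrite big_mkord.
have -> : (1 - q) * \sum_(k < n) q ^+ k = 1 - q ^+ n 
  by rewrite -[1 - q]opprB mulNr -subrX1 opprB.
by rewrite gerBl exprn_ge0.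
Qed.

(** Cutting by the integer part of the absolute value of [Y] gives a geometric series of ratio
    [expR (- (kappa / 2))]. The bound serves twice: for the entries, and with prefactor 2 for
    normalized row sums. *)
Lemma integral_expR_sqr_le (beta kappa : R) (Y : {RV P >-> R}) :
  0 < kappa -> 0 <= beta ->
  (forall t : R, 0 <= t ->
     (P [set w | (t <= `|Y w|)%R] <= (beta * expR (- kappa * t ^+ 2))%:E)%E) ->
  (\int[P]_w (expR (kappa / 4 * Y w ^+ 2))%:E <=
     (expsqr_bound beta kappa)%:E)%E.
Proof.
move=> k0 b0 tail.
pose A (k : nat) := [set w | (k%:R <= `|Y w|)%R].
have mA k : measurable (A k).
  rewrite -[A k]setTI; apply: (@measurable_fun_le _ _ _ _ (cst k%:R)) => //.
  exact: measurableT_comp.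
pose a (k : nat) := expR (kappa / 4 * (k.+1)%:R ^+ 2) : R.
pose f k w := (a k * \1_(A k) w)%:E.
have f0 k w : (0 <= f k w)%E by rewrite lee_fin mulr_ge0 ?expR_ge0.
have mf k : measurable_fun setT (f k).
  by apply/measurable_EFinP/measurable_funM => //; exact: measurable_indic.
apply: (@le_trans _ _ (\int[P]_w (\sum_(k <oo) f k w))%E).
  apply: ge0_le_integral => //.
  - apply/measurable_EFinP/measurableT_comp => //.
    by apply: measurable_funM => //; exact: measurable_funX.
  - exact: ge0_emeasurable_sum.
  - move=> w _; set k := Num.truncn `|Y w|.
    have /andP[kY Yk] : (k%:R <= `|Y w| < k.+1%:R) by exact/truncn_itv.
    apply: (@le_trans _ _ (f k w)).
      rewrite /f /a indicE mem_set// mulr1 lee_fin ler_expR.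
      rewrite ler_pM2l ?divr_gt0// -real_normK ?num_real//.
      by rewrite lerXn2r ?nnegrE// ltW.
    by rewrite (@nneseriesD1 _ _ k)//; apply: leeDl; apply: nneseries_ge0.
rewrite integral_nneseries//.
pose q := expR (- (kappa / 2)).
apply: lime_le; first by apply: is_cvg_nneseries => k _ _; apply: integral_ge0.
near=> n.
apply: (@le_trans _ _ (\sum_(0 <= k < n) (beta * expR (kappa / 2) * q ^+ k)%:E)%E).
  apply: lee_sum => k _; rewrite /f.
  under eq_integral do rewrite EFinM.
  have mI : measurable_fun setT (fun w => (\1_(A k) w)%:E : \bar R).
    by apply/measurable_EFinP; exact: measurable_indic.
  rewrite (ge0_integralZl P measurableT mI) ?lee_fin ?expR_ge0//.
  rewrite integral_indic// setIT.
  apply: (@le_trans _ _ ((a k)%:E * (beta * expR (- kappa * k%:R ^+ 2))%:E)%E).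
    by rewrite lee_pmul ?lee_fin ?expR_ge0// tail.
  rewrite -EFinM lee_fin mulrCA -mulrA ler_wpM2l// /a /q -expRD -expRM_natl -expRD.
  rewrite ler_expR -[k.+1%:R]natr1.
  (* Up to the factor [kappa / 4] the exponents differ by 3k^2 - 4k + 1 = 2(k^2 - k) + (k - 1)^2,
     and k^2 >= k because [k] is an integer. *)
  have xx : 0 <= kappa * (k%:R ^+ 2 - k%:R).
    rewrite mulr_ge0 ?(ltW k0)// subr_ge0 -natrX ler_nat.
    by case: (k) => // j; rewrite expnS leq_pmulr// expn1.
  have x1 : 0 <= kappa * (k%:R - 1) ^+ 2 by rewrite mulr_ge0 ?sqr_ge0 ?(ltW k0).
  by nra.
rewrite sumEFin -mulr_sumr lee_fin /expsqr_bound ler_wpM2l ?mulr_ge0 ?expR_ge0//.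
by apply: geometric_sum_le; rewrite expR_ge0 -expR0 ltr_expR oppr_lt0 divr_gt0.
Unshelve. all: by end_near. Qed.

End SubGaussianTails.

(** * Sub-Gaussian linear combinations *)

Section RealInequalities.
Context {R : realType}.
Implicit Types x y w mu th : R.

(** For a centred variable the linear term integrates to 0, leaving only a square in the exponent.
    Up to 1/2 the bound follows from [(1 - x) * expR x <= 1]; beyond, from [x <= 2 * x ^+ 2]. *)
Lemma expR_le_id_addsqr x : expR x <= x + expR (2 * x ^+ 2).
Proof.
have [x2|x2] := lerP x 2^-1; last first.
  have : expR x <= expR (2 * x ^+ 2) by rewrite ler_expR; nra.
  by move: x2; lra.
have h : expR (- x) >= 1 - x by exact: expR_ge1Dx.
have e0 : 0 < expR x := expR_gt0 _.
have ee : expR (- x) * expR x = 1 by rewrite -expRD addNr expR0.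
have {}h : (1 - x) * expR x <= 1 by move: h; rewrite -(ler_pM2r e0) ee.
have := expR_ge1Dx (2 * x ^+ 2).
have : (1 - x) * expR x <= (1 - x) * (1 + x + 2 * x ^+ 2).
  apply: le_trans h _; have : 0 <= x ^+ 2 * (1 - 2 * x) by apply: mulr_ge0; [exact: sqr_ge0|lra].
  by nra.
rewrite ler_pM2l; last by lra.
by lra.
Qed.

(** Compare both sides with 1/(1 + x): the product (1 + x)(1 - x + x^2) equals 1 + x^3. *)
Lemma expRN_le_quadratic x : 0 <= x -> expR (- x) <= 1 - x + x ^+ 2.
Proof.
move=> x0; rewrite expRN; have h := expR_ge1Dx x.
apply: (@le_trans _ _ (1 + x)^-1); first by rewrite lef_pV2 ?posrE ?expR_gt0//; lra.
rewrite -[leLHS]mul1r ler_pdivrMr; last by lra.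
have : 0 <= x ^+ 3 by exact: exprn_ge0.
by rewrite !exprS expr0; nra.
Qed.

Lemma pow4_le_expR_sqr mu y : 0 < mu ->
  y ^+ 4 <= 4 / mu ^+ 2 * expR (mu * y ^+ 2).
Proof.
move=> mu0; rewrite mulrAC ler_pdivlMr ?exprn_gt0//.
have w0 : 0 <= mu * y ^+ 2 by rewrite mulr_ge0 ?sqr_ge0 ?ltW.
set w := mu * y ^+ 2 in w0 *.
have -> : y ^+ 4 * mu ^+ 2 = w ^+ 2 by rewrite /w; ring.
have -> : expR w = expR (w / 2) ^+ 2.
  by rewrite -expRM_natl; congr expR; field.
have := expR_ge1Dx (w / 2); set e := expR _; nra.
Qed.

(** Convexity, from the tangent at [th * w] evaluated at 0 and at [w]. It serves to lower the
    parameter of an exponential square moment. *)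
Lemma expR_convex0 th w : 0 <= th <= 1 ->
  expR (th * w) <= 1 - th + th * expR w.
Proof.
move=> /andP[th0 th1]; set p := th * w.
have e0 : 0 <= expR p := expR_ge0 _.
have h1 : expR p * (1 + (w - p)) <= expR w.
  have -> : expR w = expR p * expR (w - p) by rewrite -expRD addrC subrK.
  by rewrite ler_wpM2l// expR_ge1Dx.
have h0 : expR p * (1 - p) <= 1.
  have e1 : expR p * expR (- p) = 1 by rewrite -expRD subrr expR0.
  by rewrite -[leRHS]e1 ler_wpM2l// expR_ge1Dx.
have : expR p = (1 - th) * (expR p * (1 - p)) + th * (expR p * (1 + (w - p))).
  by rewrite /p; ring.
by move=> {1}->; rewrite -[X in _ <= X + _]mulr1 lerD// ler_wpM2l// subr_ge0.
Qed.

End RealInequalities.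

Section SubGaussianMoments.
Context {dT : measure_display} {T : measurableType dT} {R : realType}.
Variable (P : probability T R).

Lemma integrable_dominated (f g : T -> R) (c : R) :
  measurable_fun setT f -> measurable_fun setT g ->
  (forall w, `|f w| <= g w) -> (\int[P]_w (g w)%:E <= c%:E)%E ->
  P.-integrable setT (EFin \o f).
Proof.
move=> mf mg fg gc; apply: (@le_integrable _ _ _ P setT _ _ (EFin \o g)) => //.
- exact/measurable_EFinP.
- by move=> w _ /=; rewrite lee_fin (le_trans (fg w)) ?ler_norm.
apply/integrableP; split; first exact/measurable_EFinP.
under eq_integral => w _ do
  rewrite /= ger0_norm ?(le_trans (normr_ge0 (f w)) (fg w))//.
by apply: le_lt_trans gc _; exact: ltry.
Qed.

Lemma measurable_expR_sqr (mu : R) (Y : T -> R) : measurable_fun setT Y ->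
  measurable_fun setT (fun w => expR (mu * Y w ^+ 2)).
Proof.
move=> mY; apply: measurableT_comp => //.
by apply: measurable_funM => //; exact: measurable_funX.
Qed.

Lemma integral_add_scale (g : T -> R) (a b c : R) :
  measurable_fun setT g -> (forall w, 0 <= g w) -> 0 <= a -> 0 <= b ->
  (\int[P]_w (g w)%:E <= c%:E -> \int[P]_w (a + b * g w)%:E <= (a + b * c)%:E)%E.
Proof.
move=> mg g0 a0 b0 gc.
under eq_integral do rewrite EFinD EFinM.
have mgE : measurable_fun setT (EFin \o g) by exact/measurable_EFinP.
rewrite ge0_integralD//; last 2 first.
- by move=> w _; rewrite mule_ge0 ?lee_fin.
- exact: measurable_funeM.
rewrite ge0_integralZl ?lee_fin//; last by move=> w _; rewrite lee_fin.
rewrite integral_cst//= probability_setT mule1 EFinD leeD2l// EFinM.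
by rewrite lee_pmul ?lee_fin//; apply: integral_ge0 => w _; rewrite lee_fin.
Qed.

Lemma integrable_of_expR_sqr (mu M : R) (X : {RV P >-> R}) : 0 < mu ->
  (\int[P]_w (expR (mu * X w ^+ 2))%:E <= M%:E)%E ->
  P.-integrable setT (EFin \o X).
Proof.
move=> mu0 XM.
apply: (@integrable_dominated X (fun w => 1 + mu^-1 * expR (mu * X w ^+ 2)) (1 + mu^-1 * M)) => //.
- apply: measurable_funD => //; apply: measurable_funM => //.
  exact: measurable_expR_sqr.
- move=> w; apply: (@le_trans _ _ (1 + X w ^+ 2)).
    rewrite -[X w ^+ 2]real_normK ?num_real//.
    by set y := `|_|; have := sqr_ge0 (y - 1); have := normr_ge0 (X w); rewrite -/y; nra.
  rewrite lerD2l ler_pdivlMl//.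
  by apply: le_trans (expR_ge1Dx _); rewrite lerDr.
- apply: integral_add_scale => //.
  + exact: measurable_expR_sqr.
  + by rewrite invr_ge0 ltW.
Qed.

(** For small [t], [expR_le_id_addsqr] uses up the zero mean and convexity bounds the rest by the
    moment at [mu]. For large [t], Young's inequality [t * x <= t ^+ 2 / (4 * mu) + mu * x ^+ 2] is
    enough, since [2 * t ^+ 2 / mu] is then at least 1 and can multiply [M]. *)
Lemma mgf_le (mu M : R) (X : {RV P >-> R}) (t : R) : 0 < mu -> 0 <= M ->
  (\int[P]_w (X w)%:E = 0)%E ->
  (\int[P]_w (expR (mu * X w ^+ 2))%:E <= M%:E)%E ->
  (\int[P]_w (expR (t * X w))%:E <= (expR (2 * (M + 1) / mu * t ^+ 2))%:E)%E.
Proof.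
move=> mu0 M0 X0 XM.
have mE : measurable_fun setT (fun w => expR (t * X w)).
  by apply: measurableT_comp => //; exact: measurable_funM.
have mE2 := @measurable_expR_sqr mu X (measurable_funP X).
have [tmu|tmu] := lerP (2 * t ^+ 2) mu.
  (* The weight with [th * mu = 2 * t ^+ 2]; the case distinction says that it is at most 1. *)
  set th := 2 * t ^+ 2 / mu.
  have th0 : 0 <= th by rewrite divr_ge0 ?(ltW mu0)// mulr_ge0 ?sqr_ge0.
  have th1 : th <= 1 by rewrite ler_pdivrMr ?mul1r.
  have iX : P.-integrable setT (fun w => (t * X w)%:E).
    apply: (@integrableZl _ _ _ P _ measurableT t (EFin \o X)).
    exact: (integrable_of_expR_sqr mu0 XM).
  pose g w := 1 - th + th * expR (mu * X w ^+ 2).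
  have gE w : expR (2 * (t * X w) ^+ 2) <= g w.
    apply: le_trans (expR_convex0 (mu * X w ^+ 2) _); last by rewrite th0.
    by rewrite ler_expR /th mulrA divfK ?gt_eqF// exprMn mulrA.
  have mg : measurable_fun setT g.
    by apply: measurable_funD => //; exact: measurable_funM.
  have g0 w : 0 <= g w by rewrite addr_ge0 ?subr_ge0// mulr_ge0 ?expR_ge0.
  have gM : (\int[P]_w (g w)%:E <= (1 - th + th * M)%:E)%E.
    by apply: integral_add_scale => //; rewrite subr_ge0.
  have ig : P.-integrable setT (EFin \o g).
    by apply: (integrable_dominated _ _ _ gM) => // w; rewrite ger0_norm.
  apply: (@le_trans _ _ (\int[P]_w ((t * X w)%:E + (g w)%:E))%E).
    apply: le_integral => //.
    - apply: (@integrable_dominated _ (fun w => `|t * X w| + g w)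
        (fine (\int[P]_w `|(t * X w)%:E|) + (1 - th + th * M))%R) => //.
      + apply: measurable_funD => //; apply: measurableT_comp => //.
        exact: measurable_funM.
      + move=> w; rewrite ger0_norm ?expR_ge0//.
        by apply: le_trans (expR_le_id_addsqr _) _; apply: lerD; rewrite ?ler_norm.
      + under eq_integral do rewrite EFinD.
        have mtX : measurable_fun setT (fun w => `|t * X w|%:E).
          by apply/measurable_EFinP/measurableT_comp => //; exact: measurable_funM.
        rewrite ge0_integralD//; last 2 first.
          by move=> w _; rewrite lee_fin.
          exact/measurable_EFinP.
        rewrite EFinD leeD// fineK//.
        by have /integrableP[_] := iX; rewrite ge0_fin_numE// integral_ge0.
    - exact: (integrableD measurableT iX ig).
    - move=> w; rewrite inE -EFinD lee_fin => _.
      by apply: le_trans (expR_le_id_addsqr _) _; rewrite lerD2l.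
  rewrite integralD//.
  have -> : (\int[P]_w (t * X w)%:E = 0)%E.
    under eq_integral do rewrite EFinM.
    by rewrite integralZl// ?X0 ?mule0//; exact: (integrable_of_expR_sqr mu0 XM).
  rewrite add0e; apply: le_trans gM _; rewrite lee_fin.
  have h := expR_ge1Dx (th * M); have thM : 0 <= th * M by exact: mulr_ge0.
  apply: (@le_trans _ _ (expR (th * M))); first by move: th0 h; lra.
  rewrite ler_expR.
  have -> : 2 * (M + 1) / mu * t ^+ 2 = th * (M + 1) by rewrite /th; field; rewrite gt_eqF.
  by rewrite ler_wpM2l// lerDl.
apply: (@le_trans _ _ (\int[P]_w ((expR (t ^+ 2 / (4 * mu)))%:E * (expR (mu * X w ^+ 2))%:E))%E).
  apply: ge0_le_integral => //.
  - exact/measurable_EFinP.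
  - by apply: measurable_funeM; exact/measurable_EFinP.
  - move=> w _; rewrite -EFinM lee_fin -expRD ler_expR.
    have := sqr_ge0 (t / (2 * mu) - X w); rewrite -(pmulr_rge0 _ mu0).
    have -> : mu * (t / (2 * mu) - X w) ^+ 2 =
      t ^+ 2 / (4 * mu) + mu * X w ^+ 2 - t * X w by field; rewrite gt_eqF.
    by rewrite subr_ge0.
have mE2E : measurable_fun setT (fun w => (expR (mu * X w ^+ 2))%:E).
  exact/measurable_EFinP.
rewrite (ge0_integralZl P measurableT mE2E) ?lee_fin ?expR_ge0//.
apply: (@le_trans _ _ ((expR (t ^+ 2 / (4 * mu)))%:E * M%:E)%E).
  rewrite lee_pmul ?lee_fin ?expR_ge0//.
  by apply: integral_ge0 => w _; rewrite lee_fin expR_ge0.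
rewrite -EFinM lee_fin.
apply: (@le_trans _ _ (expR (t ^+ 2 / (4 * mu)) * expR M)).
  by rewrite ler_wpM2l ?expR_ge0// (le_trans _ (expR_ge1Dx _))// lerDr.
rewrite -expRD ler_expR.
have -> : 2 * (M + 1) / mu * t ^+ 2 =
    t ^+ 2 / (4 * mu) + (2 * t ^+ 2 / mu * M + 7 / 4 * (t ^+ 2 / mu)).
  by field; rewrite gt_eqF.
rewrite lerD2l; apply: (@le_trans _ _ (2 * t ^+ 2 / mu * M)).
  rewrite -[leLHS]mul1r ler_wpM2r// ler_pdivlMr// mul1r ltW//.
by rewrite lerDl mulr_ge0// divr_ge0 ?sqr_ge0 ?ltW.
Qed.

End SubGaussianMoments.

Section LinearCombinations.
Context {dT : measure_display} {T : measurableType dT} {R : realType}.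
Variables (P : probability T R) (I : finType) (X : I -> {RV P >-> R}).
Hypothesis indepX : mutually_independent X.
Variables (mu M : R).
Hypotheses (mu_gt0 : 0 < mu) (M_ge0 : 0 <= M).
Hypothesis meanX : forall i, (\int[P]_w (X i w)%:E = 0)%E.
Hypothesis varX : forall i, (\int[P]_w (X i w ^+ 2)%:E = 1)%E.
Hypothesis expX : forall i, (\int[P]_w (expR (mu * X i w ^+ 2))%:E <= M%:E)%E.

Definition lincomb (s : seq I) (z : I -> R) (w : T) : R :=
  \sum_(i <- s) z i * X i w.

Lemma lincomb_measurable_wrt (J : {set I}) (s : seq I) (z : I -> R) :
  {subset s <= J} -> measurable_wrt X J (lincomb s z).
Proof.
elim: s => [_|i s ih sJ]; rewrite /measurable_wrt /lincomb.
  by under eq_fun do rewrite big_nil; exact: measurable_cst.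
under eq_fun do rewrite big_cons.
apply: measurable_funD; last by apply: ih => j js; rewrite sJ// inE js orbT.
apply: measurable_funM; first exact: measurable_cst.
exact: (measurable_wrt_coord (sJ i (mem_head i s))).
Qed.

Lemma measurable_lincomb (s : seq I) (z : I -> R) :
  measurable_fun setT (lincomb s z).
Proof.
apply: (@measurable_wrtT _ _ _ P I X _ _ [set: I]%SET).
by apply: lincomb_measurable_wrt => i; rewrite inE.
Qed.

HB.instance Definition _ (s : seq I) (z : I -> R) :=
  isMeasurableFun.Build _ _ _ _ (lincomb s z) (measurable_lincomb s z).

Lemma mgf_lincomb_le (s : seq I) (z : I -> R) (t : R) : uniq s ->
  (\int[P]_w (expR (t * lincomb s z w))%:E <=
   (expR (2 * (M + 1) / mu * t ^+ 2 * \sum_(i <- s) z i ^+ 2))%:E)%E.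
Proof.
move=> us; pose c i := expR (2 * (M + 1) / mu * (t * z i) ^+ 2).
have -> : expR (2 * (M + 1) / mu * t ^+ 2 * \sum_(i <- s) z i ^+ 2) =
    \prod_(i <- s) c i.
  rewrite mulr_sumr expR_sum; apply: eq_bigr => i _; rewrite /c; congr expR.
  by ring.
under eq_integral => w _ do rewrite /lincomb mulr_sumr expR_sum.
apply: (@integral_prod_indep_le _ _ _ P I X indepX I s (fun i => [set i]%SET)
  (fun i w => expR (t * (z i * X i w))) c us).
- by move=> i j ij; rewrite disjoints1 inE.
- move=> i; apply: (@measurable_wrt_comp _ _ _ P I X _ _ _ _ _
    (fun x => expR (t * (z i * x))) (X i)).
    by apply: measurableT_comp => //; do !apply: measurable_funM => //.
  by apply: measurable_wrt_coord; rewrite inE.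
- by move=> i w; exact: expR_ge0.
- move=> i; under eq_integral do rewrite mulrA.
  exact: mgf_le.
Qed.

(** Chernoff on each side. The result has the shape of the tail hypothesis on the entries, with
    constants free of the number of terms, so exponential square moments can be derived again for
    row sums. *)
Lemma lincomb_tail (s : seq I) (z : I -> R) (t : R) : uniq s -> 0 <= t ->
  \sum_(i <- s) z i ^+ 2 = 1 ->
  (P [set w | (t <= `|lincomb s z w|)%R] <=
   (2 * expR (- (4 * (2 * (M + 1) / mu))^-1 * t ^+ 2))%:E)%E.
Proof.
move=> us t0 z1; set K := 2 * (M + 1) / mu.
have K0 : 0 < K by rewrite divr_gt0// mulr_gt0// ltr_wpDl.
(* At [t = 0] the right-hand side is 2; the Chernoff parameter below has to be positive. *)
have [{t0}t0|] := ltP 0 t; last first.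
  move=> t0'; have -> : t = 0 by apply/eqP; rewrite eq_le t0' t0.
  rewrite expr0n mulr0 expR0 mulr1 (le_trans (probability_le1 _ _))//.
    rewrite -[X in measurable X]setTI.
    apply: (@measurable_fun_le _ _ _ _ (cst 0)) => //.
    exact: measurableT_comp (measurable_lincomb _ _).
  by rewrite lee_fin ler1n.
have one_sided z' : \sum_(i <- s) z' i ^+ 2 = 1 ->
    (P [set w | (t <= lincomb s z' w)%R] <= (expR (- (4 * K)^-1 * t ^+ 2))%:E)%E.
  (* The minimizer of [K * r ^+ 2 - r * t], with minimum [- t ^+ 2 / (4 * K)]. *)
  move=> z'1; pose r := t / (2 * K).
  have r0 : 0 < r by rewrite divr_gt0// mulr_gt0.
  apply: (le_trans (@chernoff _ _ _ P (lincomb s z' : {RV P >-> R}) r t r0)).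
  apply: (@le_trans _ _ ((expR (K * r ^+ 2))%:E * (expR (- (r * t)))%:E)%E).
    rewrite lee_pmul ?lee_fin ?expR_ge0//; last first.
      have := @mgf_lincomb_le s z' r us; rewrite z'1 mulr1; apply: le_trans.
      rewrite /mmt_gen_fun unlock le_eqVlt; apply/orP; left; apply/eqP.
      by apply: eq_integral => w _ /=; rewrite mulrC.
    by rewrite /mmt_gen_fun unlock; apply: integral_ge0 => w _; rewrite lee_fin expR_ge0.
  rewrite -EFinM lee_fin -expRD ler_expR /r.
  suff -> : K * (t / (2 * K)) ^+ 2 - t / (2 * K) * t = - (4 * K)^-1 * t ^+ 2 by [].
  by field; rewrite gt_eqF.
have mle z' : measurable [set w | t <= lincomb s z' w].
  rewrite -[X in measurable X]setTI.
  by apply: (@measurable_fun_le _ _ _ _ (cst t)) => //; exact: measurable_lincomb.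
have mlz : forall w, lincomb s (fun i => - z i) w = - lincomb s z w.
  by move=> w; rewrite /lincomb -sumrN; apply: eq_bigr => i _; rewrite mulNr.
apply: (@le_trans _ _ (P ([set w | t <= lincomb s z w] `|`
    [set w | t <= lincomb s (fun i => - z i) w]))).
  apply: le_measure; rewrite ?inE.
  - rewrite -[X in measurable X]setTI.
    apply: (@measurable_fun_le _ _ _ _ (cst t)) => //.
    exact: measurableT_comp (measurable_lincomb _ _).
  - exact: measurableU.
  - by move=> w /=; rewrite mlz ler_normr => /orP.
apply: le_trans (measureU2 _ _ _) _ => //.
rewrite mulr_natl mulr2n EFinD leeD// one_sided//.
by rewrite -z1; apply: eq_bigr => i _; rewrite sqrrN.
Qed.

Lemma integral_sqr_affine i (a b : R) :
  (\int[P]_w ((a * X i w + b) ^+ 2)%:E = (a ^+ 2 + b ^+ 2)%:E)%E.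
Proof.
have iX := integrable_of_expR_sqr mu_gt0 (expX i).
have iX2 : P.-integrable setT (fun w => (X i w ^+ 2)%:E).
  apply: (@integrable_dominated _ _ _ P (fun w => X i w ^+ 2) (fun w => X i w ^+ 2) 1) => //.
  - exact: measurable_funX.
  - exact: measurable_funX.
  - by move=> w; rewrite ger0_norm ?sqr_ge0.
  - by rewrite varX.
have -> : (fun w => ((a * X i w + b) ^+ 2)%:E) =
    (fun w => (a ^+ 2)%:E * (X i w ^+ 2)%:E + (2 * a * b)%:E * (X i w)%:E + (b ^+ 2)%:E)%E.
  by apply/funext => w; rewrite -!EFinM -!EFinD; congr EFin; ring.
have i1 := integrableZl measurableT (a ^+ 2) iX2.
have i2 := integrableZl measurableT (2 * a * b) iX.
rewrite integralD//; last 2 first.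
- exact: (integrableD measurableT i1 i2).
- exact: finite_measure_integrable_cst.
rewrite integralD// integralZl// integralZl// varX meanX mule0 adde0 mule1.
by rewrite integral_cst//= probability_setT mule1.
Qed.

(** With the rest of the sum frozen by independence, a new centred variable contributes [z i ^+ 2]
    and no cross term. *)
Lemma integral_lincomb_sqr (s : seq I) (z : I -> R) : uniq s ->
  (\int[P]_w (lincomb s z w ^+ 2)%:E = (\sum_(i <- s) z i ^+ 2)%:E)%E.
Proof.
elim: s => [_|i s ih /= /andP[iNs us]].
  under eq_integral do rewrite /lincomb big_nil expr0n.
  by rewrite integral0 big_nil.
pose f (x : R * R) : \bar R := ((z i * x.2 + x.1) ^+ 2)%:E.
have mf : measurable_fun setT f.
  apply/measurable_EFinP; apply: measurable_funX; apply: measurable_funD.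
    by apply: measurable_funM => //; exact: measurable_snd.
  exact: measurable_fst.
have f0 x : (0 <= f x)%E by rewrite lee_fin sqr_ge0.
under eq_integral do rewrite /lincomb big_cons -/(lincomb s z _).
rewrite -[LHS]/(\int[P]_w f (lincomb s z w, X i w))%E.
rewrite (@ge0_integral_indep _ _ _ P I X indepX _ _ _ _
  [set j in s]%SET [set i]%SET)//; last 3 first.
- by rewrite disjoint_sym disjoints1 inE.
- by apply: lincomb_measurable_wrt => j; rewrite inE.
- by apply: measurable_wrt_coord; rewrite inE.
rewrite /f /=; under eq_integral do rewrite integral_sqr_affine EFinD.
have mS : measurable_fun setT (fun w => (lincomb s z w ^+ 2)%:E).
  by apply/measurable_EFinP/measurable_funX; exact: measurable_lincomb.
rewrite ge0_integralD//; last 2 first.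
- by move=> w _; rewrite lee_fin sqr_ge0.
- by move=> w _; rewrite lee_fin sqr_ge0.
by rewrite ih// integral_cst//= probability_setT mule1 big_cons EFinD.
Qed.

End LinearCombinations.

(** * Concentration of row energies *)

Section UnionBound.
Context {dT : measure_display} {T : measurableType dT} {R : realType}.
Variable (P : probability T R).

Lemma union_bound (J : Type) (s : seq J) (A : J -> set T) (c : J -> R) :
  (forall j, measurable (A j)) -> (forall j, P (A j) <= (c j)%:E)%E ->
  (P (\big[setU/set0]_(j <- s) A j) <= (\sum_(j <- s) c j)%:E)%E.
Proof.
move=> mA Ac; elim: s => [|j s ih]; first by rewrite !big_nil measure0.
rewrite !big_cons EFinD; apply: le_trans (measureU2 _ _ _) _ => //.
  by elim: s {ih} => [|i s ih]; rewrite ?big_nil// big_cons; exact: measurableU.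
exact: (leeD (Ac j) ih).
Qed.

Lemma markov_le (g : T -> R) (a c : R) : measurable_fun setT g ->
  (forall w, 0 <= g w) -> 0 < c -> (\int[P]_w (g w)%:E <= a%:E)%E ->
  (P [set w | (c <= g w)%R] <= (a / c)%:E)%E.
Proof.
move=> mg g0 c0 ga.
have mA : measurable [set w | c <= g w].
  by rewrite -[X in measurable X]setTI; exact: (@measurable_fun_le _ _ _ _ (cst c)).
rewrite EFinM lee_pdivlMr// muleC.
apply: le_trans ga; rewrite -[[set w | c <= g w] in X in (X <= _)%E]setIT.
rewrite -integral_indic//.
have mI : measurable_fun setT (fun w => (\1_[set w | c <= g w] w)%:E : \bar R).
  by apply/measurable_EFinP; exact: measurable_indic.
rewrite -(ge0_integralZl P measurableT mI) ?lee_fin ?(ltW c0)//.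
apply: ge0_le_integral => //.
- by move=> w _; rewrite -EFinM lee_fin mulr_ge0// ltW.
- exact: measurable_funeM.
- exact/measurable_EFinP.
move=> w _; rewrite -EFinM lee_fin indicE.
have [|] := boolP (w \in [set w | c <= g w]); rewrite ?mulr0//.
by rewrite inE mulr1.
Qed.

End UnionBound.

Section RowEnergy.
Context {R : realType} (Ro : finType) (d : nat).

Definition sqnorm (z : 'cV[R]_d) : R := \sum_j z j 0 ^+ 2.

Definition energy (a : Ro -> 'I_d -> R) (D : {set Ro}) (z : 'cV[R]_d) : R :=
  \sum_(r in D) (\sum_j a r j * z j 0) ^+ 2.

(** Indices may repeat: multiplicities encode the weights of the approximated vector. Opposite signs
    may cancel, even to 0. *)
Definition net_point k (f : {ffun 'I_k -> 'I_d * bool}) : 'cV[R]_d :=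
  \sum_(i < k) (-1) ^+ (f i).2 *: delta_mx (f i).1 0.

Lemma sqnorm_ge0 z : 0 <= sqnorm z.
Proof. by apply: sumr_ge0 => j _; exact: sqr_ge0. Qed.

Lemma energy_ge0 a D z : 0 <= energy a D z.
Proof. by apply: sumr_ge0 => j _; exact: sqr_ge0. Qed.

Lemma sqnormZ (c : R) z : sqnorm (c *: z) = c ^+ 2 * sqnorm z.
Proof. by rewrite /sqnorm mulr_sumr; apply: eq_bigr => j _; rewrite mxE exprMn. Qed.

Lemma energyZ a D (c : R) z : energy a D (c *: z) = c ^+ 2 * energy a D z.
Proof.
rewrite /energy mulr_sumr; apply: eq_bigr => r _; rewrite -exprMn mulr_sumr.
by congr (_ ^+ 2); apply: eq_bigr => j _; rewrite mxE mulrCA.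
Qed.

Lemma sqnorm_eq0 z : sqnorm z = 0 -> z = 0.
Proof.
move=> z0; apply/colP => j; rewrite mxE; apply/eqP; rewrite -sqrf_eq0; apply/eqP.
by move/psumr_eq0P: z0; apply=> // i _; exact: sqr_ge0.
Qed.

End RowEnergy.

Section RowConstants.
Context {R : realType}.
Variables (mu M : R).
Hypotheses (mu_gt0 : 0 < mu) (M_ge0 : 0 <= M).

Definition row_rate : R := (4 * (2 * (M + 1) / mu))^-1.
Definition row_mu : R := row_rate / 4.
Definition row_M : R := expsqr_bound 2 row_rate.
(** Makes the fourth-moment term in [expRN_row_sum_le] exactly half of the linear one. *)
Definition lower_rate : R := row_mu ^+ 2 / (8 * row_M).
(** The exponential moment of the energy is at most [expR (row_M * #|D|)]; the summand 1 leaves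
    [expR (- #|D|)] to spare. *)
Definition energy_const : R := (row_M + 1) / row_mu.
(** The exponents per row left over in the lower and in the upper tail. *)
Definition conc_rate : R := Num.min (lower_rate / 4) 1.

Lemma expsqr_bound_gt0 (beta kappa : R) :
  0 < beta -> 0 < kappa -> 0 < expsqr_bound beta kappa.
Proof.
move=> b0 k0; rewrite divr_gt0 ?mulr_gt0 ?expR_gt0// subr_gt0 -expR0 ltr_expR.
by rewrite oppr_lt0 divr_gt0.
Qed.

Lemma row_rate_gt0 : 0 < row_rate.
Proof. by rewrite invr_gt0 mulr_gt0// divr_gt0// mulr_gt0// ltr_wpDl. Qed.

Lemma row_mu_gt0 : 0 < row_mu.
Proof. by rewrite divr_gt0// row_rate_gt0. Qed.

Lemma row_M_gt0 : 0 < row_M.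
Proof. by rewrite expsqr_bound_gt0// row_rate_gt0. Qed.

Lemma lower_rate_gt0 : 0 < lower_rate.
Proof. by rewrite divr_gt0 ?exprn_gt0 ?row_mu_gt0// mulr_gt0 ?row_M_gt0. Qed.

Lemma energy_const_gt0 : 0 < energy_const.
Proof. by rewrite divr_gt0 ?row_mu_gt0// addr_gt0 ?row_M_gt0. Qed.

Lemma conc_rate_gt0 : 0 < conc_rate.
Proof. by rewrite lt_min divr_gt0 ?lower_rate_gt0//=. Qed.

End RowConstants.

Section RowConcentration.
Context {dT : measure_display} {T : measurableType dT} {R : realType}.
Variables (P : probability T R) (Ro : finType) (d : nat).
Variable X : Ro * 'I_d -> {RV P >-> R}.
Hypothesis indepX : mutually_independent X.
Variables (mu M : R).
Hypotheses (mu_gt0 : 0 < mu) (M_ge0 : 0 <= M).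
Hypothesis meanX : forall i, (\int[P]_w (X i w)%:E = 0)%E.
Hypothesis varX : forall i, (\int[P]_w (X i w ^+ 2)%:E = 1)%E.
Hypothesis expX : forall i, (\int[P]_w (expR (mu * X i w ^+ 2))%:E <= M%:E)%E.

Implicit Types (z : 'cV[R]_d) (D : {set Ro}) (r : Ro).

Let row_index (r : Ro) : seq (Ro * 'I_d) := [seq (r, j) | j <- enum 'I_d].
Let row_sum (z : 'cV[R]_d) (r : Ro) : T -> R :=
  lincomb X (row_index r) (fun k => z k.2 0).

Definition random_energy (D : {set Ro}) (z : 'cV[R]_d) (w : T) : R :=
  energy (fun r j => X (r, j) w) D z.

Let uniq_row r : uniq (row_index r).
Proof. by rewrite map_inj_uniq ?enum_uniq// => i j []. Qed.

Let row_sumE z r w : row_sum z r w = \sum_j X (r, j) w * z j 0.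
Proof.
rewrite /row_sum /lincomb big_map big_enum /=.
by apply: eq_bigr => j _; rewrite mulrC.
Qed.

Let row_coef z r : \sum_(k <- row_index r) z k.2 0 ^+ 2 = sqnorm z.
Proof. by rewrite big_map big_enum. Qed.

Lemma random_energyE D z w : random_energy D z w = \sum_(r in D) row_sum z r w ^+ 2.
Proof. by apply: eq_bigr => r _; rewrite row_sumE. Qed.

Lemma measurable_random_energy D z : measurable_fun setT (random_energy D z).
Proof.
rewrite (_ : random_energy D z = fun w =>
    \sum_(r <- enum D) row_sum z r w ^+ 2); last first.
  by apply/funext => w; rewrite random_energyE big_enum.
by apply: measurable_sum => r; apply: measurable_funX; exact: measurable_lincomb.
Qed.

Lemma expR_row_sum_le z r : sqnorm z = 1 ->
  (\int[P]_w (expR (row_mu mu M * row_sum z r w ^+ 2))%:E <= (row_M mu M)%:E)%E.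
Proof.
move=> z1; apply: (@integral_expR_sqr_le _ _ _ P 2 (row_rate mu M)
  (lincomb X (row_index r) (fun k => z k.2 0) : {RV P >-> R})) => //.
  exact: row_rate_gt0.
move=> t t0; apply: (lincomb_tail indepX mu_gt0 M_ge0 meanX expX) => //.
by rewrite row_coef.
Qed.

(** Expand to second order: unit variance fixes the linear term, and the fourth moment is controlled
    by the exponential square moment. This is what keeps the energy from being small. *)
Lemma expRN_row_sum_le z r : sqnorm z = 1 ->
  (\int[P]_w (expR (- (lower_rate mu M * row_sum z r w ^+ 2)))%:E <=
   (expR (- (lower_rate mu M / 2)))%:E)%E.
Proof.
move=> z1; set la := lower_rate mu M; set S := row_sum z r.
have la0 : 0 < la := lower_rate_gt0 mu_gt0 M_ge0.
have m0 := row_mu_gt0 mu_gt0 M_ge0; have MM0 := row_M_gt0 mu_gt0 M_ge0.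
have mS : measurable_fun setT S by exact: measurable_lincomb.
pose b := la ^+ 2 * (4 / row_mu mu M ^+ 2).
have b0 : 0 <= b by rewrite mulr_ge0 ?sqr_ge0// divr_ge0 ?sqr_ge0.
have mE : measurable_fun setT (fun w => (expR (- (la * S w ^+ 2)))%:E).
  apply/measurable_EFinP; apply: measurableT_comp => //; apply: measurableT_comp => //.
  by apply: measurable_funM => //; exact: measurable_funX.
have mS2 : measurable_fun setT (fun w => (S w ^+ 2)%:E).
  by apply/measurable_EFinP; exact: measurable_funX.
(* The linear term is kept on the left so that only nonnegative functions are integrated. *)
have main : (\int[P]_w ((expR (- (la * S w ^+ 2)))%:E + la%:E * (S w ^+ 2)%:E) <=
    (1 + b * row_M mu M)%:E)%E.
  apply: (@le_trans _ _ (\int[P]_w (1 + b * expR (row_mu mu M * S w ^+ 2))%:E)%E).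
    apply: ge0_le_integral => //.
    - by move=> w _; rewrite -EFinM -EFinD lee_fin addr_ge0 ?expR_ge0// mulr_ge0 ?sqr_ge0// ltW.
    - by apply: emeasurable_funD => //; exact: measurable_funeM.
    - apply/measurable_EFinP/measurable_funD => //; apply: measurable_funM => //.
      exact: measurable_expR_sqr.
    move=> w _; rewrite -EFinM -EFinD lee_fin.
    have h1 := @expRN_le_quadratic R (la * S w ^+ 2) (mulr_ge0 (ltW la0) (sqr_ge0 _)).
    have h2 : la ^+ 2 * S w ^+ 4 <= b * expR (row_mu mu M * S w ^+ 2).
      by rewrite /b -mulrA ler_wpM2l ?sqr_ge0// pow4_le_expR_sqr.
    have h3 : (la * S w ^+ 2) ^+ 2 = la ^+ 2 * S w ^+ 4 by ring.
    by move: h1 h2; rewrite h3; lra.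
  apply: integral_add_scale => //; first exact: measurable_expR_sqr.
  exact: expR_row_sum_le.
move: main; rewrite ge0_integralD//; last 2 first.
- by move=> w _; rewrite -EFinM lee_fin mulr_ge0 ?sqr_ge0// ltW.
- exact: measurable_funeM.
rewrite (ge0_integralZl P measurableT mS2) ?lee_fin ?(ltW la0)//; last first.
  by move=> w _; rewrite lee_fin sqr_ge0.
rewrite /S /row_sum (integral_lincomb_sqr indepX mu_gt0 meanX varX expX)//.
rewrite row_coef z1 mule1 => main.
have bE : b * row_M mu M = la / 2.
  by rewrite /b /la /lower_rate; field; rewrite !gt_eqF.
rewrite -(@leeD2rE _ la%:E)//; apply: le_trans main _.
rewrite -EFinD lee_fin bE.
by have := expR_ge1Dx (- (la / 2)); lra.
Qed.

Let row_disjoint r r' : r != r' ->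
  [disjoint [set k in row_index r]%SET & [set k in row_index r']%SET]%bool.
Proof.
move=> rr'; rewrite -finset.setI_eq0; apply/eqP/setP => k; rewrite !inE.
by apply/negP => /andP[/mapP[j _ ->] /mapP[j' _ [rE _]]]; rewrite rE eqxx in rr'.
Qed.

Lemma integral_prod_rows_le (D : {set Ro}) (z : 'cV[R]_d) (g : R -> R) (c : R) :
  measurable_fun setT g -> (forall x, 0 <= g x) ->
  (forall r, \int[P]_w (g (row_sum z r w))%:E <= c%:E)%E ->
  (\int[P]_w (\prod_(r in D) g (row_sum z r w))%:E <= (c ^+ #|D|)%:E)%E.
Proof.
move=> mg g0 gc.
have -> : c ^+ #|D| = \prod_(r <- enum D) c by rewrite big_enum /= prodr_const.
under eq_integral do rewrite -big_enum.
apply: (integral_prod_indep_le indepX (enum_uniq D) row_disjoint) => //.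
move=> r; apply: (@measurable_wrt_comp _ _ _ P _ X _ _ _ _ _ g (row_sum z r)) => //.
by apply: lincomb_measurable_wrt => k; rewrite inE.
Qed.

(** Markov for the exponential of minus [la] times the energy: each row gains [la / 2] in the
    exponent, and the threshold costs [la / 4]. *)
Lemma energy_lower_tail (D : {set Ro}) z : sqnorm z = 1 ->
  (P [set w | (random_energy D z w <= #|D|%:R / 4)%R] <=
   (expR (- (conc_rate mu M * #|D|%:R)))%:E)%E.
Proof.
move=> z1; set la := lower_rate mu M.
have la0 : 0 < la := lower_rate_gt0 mu_gt0 M_ge0.
pose G w := \prod_(r in D) expR (- (la * row_sum z r w ^+ 2)).
have GE w : G w = expR (- (la * random_energy D z w)).
  by rewrite /G -expR_sum random_energyE mulr_sumr sumrN.
have mG : measurable_fun setT G.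
  rewrite (funext GE); apply: measurableT_comp => //; apply: measurableT_comp => //.
  by apply: measurable_funM => //; exact: measurable_random_energy.
have -> : [set w | random_energy D z w <= #|D|%:R / 4] =
    [set w | expR (- (la * (#|D|%:R / 4))) <= G w].
  by apply/seteqP; split => w /=; rewrite GE ler_expR lerN2 ler_pM2l.
apply: le_trans (@markov_le _ _ _ P G (expR (- (la / 2)) ^+ #|D|) _ mG _ _ _) _.
- by move=> w; rewrite GE expR_ge0.
- exact: expR_gt0.
- rewrite /G; apply: (@integral_prod_rows_le D z (fun x => expR (- (la * x ^+ 2)))) => //.
  + apply: measurableT_comp => //; apply: measurableT_comp => //.
    by apply: measurable_funM => //; exact: measurable_funX.
  + by move=> r; exact: expRN_row_sum_le.
rewrite lee_fin -expRM_natl -expRN -expRD ler_expR opprK.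
have : conc_rate mu M <= la / 4 by rewrite ge_min lexx.
move=> /(ler_wpM2r (ler0n R #|D|)) h.
by move: h; set m := #|D|%:R; rewrite /la; lra.
Qed.

Lemma energy_upper_tail (D : {set Ro}) z : sqnorm z = 1 ->
  (P [set w | (energy_const mu M * #|D|%:R <= random_energy D z w)%R] <=
   (expR (- (conc_rate mu M * #|D|%:R)))%:E)%E.
Proof.
move=> z1; set m := row_mu mu M.
have m0 : 0 < m := row_mu_gt0 mu_gt0 M_ge0; have MM0 := row_M_gt0 mu_gt0 M_ge0.
pose G w := \prod_(r in D) expR (m * row_sum z r w ^+ 2).
have GE w : G w = expR (m * random_energy D z w).
  by rewrite /G -expR_sum random_energyE mulr_sumr.
have mG : measurable_fun setT G.
  rewrite (funext GE); apply: measurableT_comp => //.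
  by apply: measurable_funM => //; exact: measurable_random_energy.
have -> : [set w | energy_const mu M * #|D|%:R <= random_energy D z w] =
    [set w | expR (m * (energy_const mu M * #|D|%:R)) <= G w].
  by apply/seteqP; split => w /=; rewrite GE ler_expR ler_pM2l.
apply: le_trans (@markov_le _ _ _ P G (row_M mu M ^+ #|D|) _ mG _ _ _) _.
- by move=> w; rewrite GE expR_ge0.
- exact: expR_gt0.
- rewrite /G; apply: (@integral_prod_rows_le D z (fun x => expR (m * x ^+ 2))) => //.
  + by apply: measurableT_comp => //; apply: measurable_funM => //; exact: measurable_funX.
  + by move=> r; exact: expR_row_sum_le.
rewrite lee_fin ler_pdivrMr ?expR_gt0//.
have -> : m * (energy_const mu M * #|D|%:R) = (row_M mu M + 1) * #|D|%:R.
  by rewrite /energy_const -/m; field; rewrite gt_eqF.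
apply: (@le_trans _ _ (expR (row_M mu M) ^+ #|D|)).
  by rewrite lerXn2r ?nnegrE ?expR_ge0 ?(ltW MM0)// (le_trans _ (expR_ge1Dx _))// lerDr.
rewrite -expRM_natl -expRD ler_expR.
have : conc_rate mu M <= 1 by rewrite ge_min lexx orbT.
move=> /(ler_wpM2r (ler0n R #|D|)) h.
by move: h; set k := #|D|%:R; lra.
Qed.

End RowConcentration.

Section NetEvent.
Context {dT : measure_display} {T : measurableType dT} {R : realType}.
Variables (P : probability T R) (Ro : finType) (d : nat).
Variable X : Ro * 'I_d -> {RV P >-> R}.
Hypothesis indepX : mutually_independent X.
Variables (mu M : R).
Hypotheses (mu_gt0 : 0 < mu) (M_ge0 : 0 <= M).
Hypothesis meanX : forall i, (\int[P]_w (X i w)%:E = 0)%E.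
Hypothesis varX : forall i, (\int[P]_w (X i w ^+ 2)%:E = 1)%E.
Hypothesis expX : forall i, (\int[P]_w (expR (mu * X i w ^+ 2))%:E <= M%:E)%E.

Definition well_conditioned (C : R) (a : Ro -> 'I_d -> R) (D : {set Ro}) k :=
  forall f : {ffun 'I_k -> 'I_d * bool},
    #|D|%:R / 4 * sqnorm (net_point f : 'cV[R]_d) <= energy a D (net_point f)
      <= C * #|D|%:R * sqnorm (net_point f : 'cV[R]_d).

Implicit Types (z : 'cV[R]_d) (D : {set Ro}).

Let unit_vector (z : 'cV[R]_d) : 'cV[R]_d := (Num.sqrt (sqnorm z))^-1 *: z.

(** A net point whose signs cancel cannot be normalized; both energy bounds hold trivially there, so
    nothing has to be excluded. *)
Let bad D (z : 'cV[R]_d) : set T := if z == 0 then set0 else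
  [set w | random_energy X D (unit_vector z) w <= #|D|%:R / 4] `|`
  [set w | energy_const mu M * #|D|%:R <= random_energy X D (unit_vector z) w].

Let unit_vector_sqnorm z : z != 0 -> sqnorm (unit_vector z) = 1.
Proof.
move=> z0; rewrite sqnormZ exprVn sqr_sqrtr ?sqnorm_ge0// mulVf//.
by apply: contra_neq z0; exact: sqnorm_eq0.
Qed.

Let unit_vectorE z : z != 0 -> z = Num.sqrt (sqnorm z) *: unit_vector z.
Proof.
move=> z0; rewrite scalerA divff ?scale1r// sqrtr_eq0 -ltNge lt_neqAle.
rewrite sqnorm_ge0 andbT eq_sym.
by apply: contra_neq z0; exact: sqnorm_eq0.
Qed.

Let measurable_bad D z : measurable (bad D z).
Proof.
rewrite /bad; case: ifP => // _; have mE := measurable_random_energy X D (unit_vector z).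
apply: measurableU; rewrite -[X in measurable X]setTI.
  exact: (@measurable_fun_le _ _ _ _ _ (cst _)).
exact: (@measurable_fun_le _ _ _ _ (cst _)).
Qed.

Lemma well_conditioned_event D k : exists B : set T, [/\ measurable B,
  (P B <= ((2 * d) ^ k)%:R%:E * (2 * expR (- (conc_rate mu M * #|D|%:R)))%:E)%E &
  forall w, ~ B w ->
    well_conditioned (energy_const mu M) (fun r j => X (r, j) w) D k].
Proof.
exists (\big[setU/set0]_(f <- enum {ffun 'I_k -> 'I_d * bool}) bad D (net_point f)).
split.
- by elim: (enum _) => [|f s ih]; rewrite ?big_nil// big_cons; exact: measurableU.
- apply: (le_trans (@union_bound _ _ _ P _ _ _
    (fun=> 2 * expR (- (conc_rate mu M * #|D|%:R))) _ _)) => // [f|].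
    rewrite /bad; case: ifPn => [_|z0].
      by rewrite measure0 lee_fin mulr_ge0 ?expR_ge0.
    have mE := measurable_random_energy X D (unit_vector (net_point f)).
    apply: le_trans (measureU2 _ _ _) _.
    + rewrite -[X in measurable X]setTI.
      exact: (@measurable_fun_le _ _ _ _ _ (cst _)).
    + rewrite -[X in measurable X]setTI.
      exact: (@measurable_fun_le _ _ _ _ (cst _)).
    rewrite [2 * _]mulr_natl [_ *+ 2]mulr2n EFinD; apply: leeD.
      by apply: energy_lower_tail => //; exact: unit_vector_sqnorm.
    by apply: energy_upper_tail => //; exact: unit_vector_sqnorm.
  rewrite big_enum/= sumr_const -EFinM lee_fin -[leLHS]mulr_natl.
  rewrite ler_wpM2r ?mulr_ge0 ?expR_ge0// ler_nat.
  by rewrite card_ffun card_prod card_ord card_bool card_ord mulnC.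
move=> w Bw f.
have {}Bw : ~ bad D (net_point f) w.
  move=> bw; apply: Bw; rewrite -bigcup_seq; exists f => //=; exact: mem_enum.
set z := net_point f in Bw *.
have [->|z0] := eqVneq z 0.
  have e0 : energy (fun r j => X (r, j) w) D (0 : 'cV[R]_d) = 0.
    by rewrite -(scale0r (0 : 'cV[R]_d)) energyZ expr0n mul0r.
  have s0 : sqnorm (0 : 'cV[R]_d) = 0.
    by rewrite -(scale0r (0 : 'cV[R]_d)) sqnormZ expr0n mul0r.
  by rewrite e0 s0 !mulr0 lexx.
move: Bw; rewrite /bad (negbTE z0) => /not_orP[/= /negP + /negP].
rewrite -!ltNge /random_energy => lo up.
rewrite [X in energy _ _ X](unit_vectorE z0) energyZ sqr_sqrtr ?sqnorm_ge0//.
by rewrite ![_ * sqnorm z]mulrC !ler_wpM2l ?sqnorm_ge0// ltW.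
Qed.

End NetEvent.

(** * Maurey approximation *)

Section Maurey.
Context {R : realType} (V : lmodType R) (B : V -> V -> R).
Hypothesis BDl : forall c x y z, B (c *: x + y) z = c * B x z + B y z.
Hypothesis Bsym : forall x y, B x y = B y x.
Hypothesis B_ge0 : forall x, 0 <= B x x.

Let B0l z : B 0 z = 0.
Proof. by have := BDl (-1) 0 0 z; rewrite scaler0 addr0; lra. Qed.

Let BsumZ (J : finType) (p : J -> R) (v : J -> V) z :
  B (\sum_j p j *: v j) z = \sum_j p j * B (v j) z.
Proof. by elim/big_rec2: _ => [|j _ y _ <-]; rewrite ?B0l ?BDl. Qed.

Let BD x y : B (x + y) (x + y) = B x x + 2 * B y x + B y y.
Proof.
have e u v w : B (u + v) w = B u w + B v w by rewrite -[u]scale1r BDl mul1r scale1r.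
by rewrite e [B x _]Bsym [B y (x + y)]Bsym !e [B x y]Bsym; ring.
Qed.

Variables (J : finType) (p : J -> R) (v : J -> V) (L : R).
Hypothesis p_ge0 : forall j, 0 <= p j.
Hypothesis p_sum : \sum_j p j = 1.
Hypothesis v_le : forall j, B (v j) (v j) <= L.

Let x := \sum_j p j *: v j.

(* Averaging over [p] kills the cross term, because the mean of [v j - x] is 0. *)
Lemma greedy_step (S : V) :
  exists j, B (S + (v j - x)) (S + (v j - x)) <= B S S + L.
Proof.
apply: contrapT => /forallNP nj.
have {}nj j : 0 < B (S + (v j - x)) (S + (v j - x)) - (B S S + L).
  by rewrite subr_gt0 ltNge; apply/negP; exact: nj.
have avg : \sum_j p j * (B (S + (v j - x)) (S + (v j - x)) - (B S S + L)) <= 0.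
  pose s := S - x.
  have E j : p j * (B (S + (v j - x)) (S + (v j - x)) - (B S S + L)) =
      p j * (B s s - (B S S + L)) + 2 * (p j * B (v j) s) + p j * B (v j) (v j).
    have -> : S + (v j - x) = s + v j by rewrite addrCA addrC.
    by rewrite (BD s (v j)); ring.
  rewrite (eq_bigr _ (fun j _ => E j)) !big_split /= -mulr_suml p_sum mul1r.
  rewrite -mulr_sumr -BsumZ -/x.
  have -> : B S S = B s s + 2 * B x s + B x x by rewrite -BD /s subrK.
  have : \sum_j p j * B (v j) (v j) <= L.
    rewrite -[leRHS]mul1r -p_sum mulr_suml; apply: ler_sum => j _.
    exact: ler_wpM2l.
  by have := B_ge0 x; lra.
have nn j : true -> 0 <= p j * (B (S + (v j - x)) (S + (v j - x)) - (B S S + L)).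
  by move=> _; rewrite mulr_ge0// ltW.
have /psumr_eq0P/(_ _) p0 := le_anti (introT andP (conj avg (sumr_ge0 _ nn))).
suff : \sum_j p j = 0 by rewrite p_sum => /eqP; rewrite oner_eq0.
apply: big1 => j _; have /eqP := p0 nn j erefl.
by rewrite mulf_eq0 [X in _ || X]gt_eqF// orbF => /eqP.
Qed.

(** Greedy choices replace the random sample: each adds at most [L] to the squared error of the sum,
    so after division by [k] the squared error is at most [L / k]. *)
Lemma maurey k : exists f : 'I_k -> J,
  B (\sum_(i < k) (v (f i) - x)) (\sum_(i < k) (v (f i) - x)) <= k%:R * L.
Proof.
(* A function on [nat] can be overwritten at [k] in the induction, whereas one on ['I_k] would have
   to change its domain. *)
suff [f fP] : exists f : nat -> J,
    B (\sum_(i < k) (v (f i) - x)) (\sum_(i < k) (v (f i) - x)) <= k%:R * L.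
  by exists f.
elim: k => [|k [f fP]].
  have [j _] := greedy_step 0.
  by exists (fun=> j); rewrite big_ord0 B0l mul0r.
have [j jP] := greedy_step (\sum_(i < k) (v (f i) - x)).
exists (fun i => if i == k then j else f i); rewrite big_ord_recr /= eqxx.
under eq_bigr => i _ do rewrite (ltn_eqF (ltn_ord i)).
by apply: le_trans jP _; rewrite -natr1 mulrDl mul1r lerD2r.
Qed.

End Maurey.

(** * Uniform quadratic bounds from the net *)

Section QuadraticBounds.
Context {R : realType} (Ro : finType) (d : nat).
Variables (a : Ro -> 'I_d -> R) (D : {set Ro}) (C : R) (k : nat).
Hypotheses (C_gt0 : 0 < C) (d_gt0 : (0 < d)%N) (D_gt0 : (0 < #|D|)%N) (k_gt0 : (0 < k)%N).
Hypothesis wc : well_conditioned C a D k.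
Implicit Types x y z : 'cV[R]_d.

Let dot x y : R := \sum_j x j 0 * y j 0.
Let arow x r := \sum_j a r j * x j 0.
Let al : R := (C * #|D|%:R)^-1.
(** One form for both norms lets a single run of [maurey] control both errors. The weight [al]
    balances them: coordinate vectors have form at most 2. *)
Let form x y : R := dot x y + al * \sum_(r in D) arow x r * arow y r.

Let Dr_gt0 : 0 < #|D|%:R :> R. Proof. by rewrite ltr0n. Qed.
Let kr_gt0 : 0 < k%:R :> R. Proof. by rewrite ltr0n. Qed.
Let al_gt0 : 0 < al. Proof. by rewrite invr_gt0 mulr_gt0. Qed.

Let formE x : form x x = sqnorm x + al * energy a D x.
Proof. by []. Qed.

Let arowD c x y r : arow (c *: x + y) r = c * arow x r + arow y r.
Proof.
rewrite /arow mulr_sumr -big_split; apply: eq_bigr => j _.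
by rewrite !mxE /=; ring.
Qed.

Let form_linear c x y z : form (c *: x + y) z = c * form x z + form y z.
Proof.
rewrite /form.
have -> : dot (c *: x + y) z = c * dot x z + dot y z.
  rewrite /dot mulr_sumr -big_split; apply: eq_bigr => j _.
  by rewrite !mxE /= mulrDl mulrA.
have -> : \sum_(r in D) arow (c *: x + y) r * arow z r =
    c * \sum_(r in D) arow x r * arow z r + \sum_(r in D) arow y r * arow z r.
  rewrite mulr_sumr -big_split; apply: eq_bigr => r _.
  by rewrite arowD /= mulrDl mulrA.
ring.
Qed.

Let form_sym x y : form x y = form y x.
Proof.
rewrite /form /dot; congr (_ + _ * _); apply: eq_bigr => ? _; exact: mulrC.
Qed.

Let form_ge0 x : 0 <= form x x.
Proof. by rewrite formE addr_ge0 ?sqnorm_ge0// mulr_ge0 ?energy_ge0// ltW. Qed.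

(** A constant choice yields a multiple of a coordinate vector, so the net condition already bounds
    the energy of every column. *)
Let net_point_const j :
  net_point ([ffun=> (j, false)] : {ffun 'I_k -> _}) = k%:R *: delta_mx j 0 :> 'cV[R]_d.
Proof.
rewrite /net_point (eq_bigr (fun=> delta_mx j 0)); last first.
  by move=> i _; rewrite ffunE /= expr0 scale1r.
by rewrite sumr_const card_ord scaler_nat.
Qed.

Let sqnorm_delta j : sqnorm (delta_mx j 0 : 'cV[R]_d) = 1.
Proof.
rewrite /sqnorm (bigD1 j)//= mxE !eqxx expr1n big1 ?addr0// => i ij.
by rewrite mxE (negbTE ij) expr0n.
Qed.

Let form_delta j : form (delta_mx j 0) (delta_mx j 0) <= 2.
Proof.
rewrite formE sqnorm_delta.
have /andP[_] := wc [ffun=> (j, false)].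
rewrite net_point_const sqnormZ energyZ sqnorm_delta mulr1 [leRHS]mulrC.
rewrite ler_pM2l ?exprn_gt0// => h.
suff : al * energy a D (delta_mx j 0 : 'cV[R]_d) <= 1 by lra.
by rewrite mulrC ler_pdivrMr ?mul1r ?mulr_gt0.
Qed.

Let formZ c x : form (c *: x) (c *: x) = c ^+ 2 * form x x.
Proof. by rewrite !formE sqnormZ energyZ; ring. Qed.

(** [x] is the mean of the signed coordinate vectors scaled by [l1norm x], with weights proportional
    to the absolute values of its entries; each has form at most [2 * l1norm x ^+ 2]. *)
Lemma sparse_approximation x :
  exists (f : {ffun 'I_k -> 'I_d * bool}) (c : R),
    sqnorm (x - c *: net_point f) <= 2 * (l1norm x ^+ 2 / k%:R) /\
    energy a D (x - c *: net_point f) <=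
      2 * (l1norm x ^+ 2 / k%:R) * (C * #|D|%:R).
Proof.
suff [f [c fc]] : exists (f : {ffun 'I_k -> 'I_d * bool}) (c : R),
    form (x - c *: net_point f) (x - c *: net_point f) <=
      2 * (l1norm x ^+ 2 / k%:R).
  exists f, c; move: fc; rewrite formE.
  have := sqnorm_ge0 (x - c *: net_point f).
  have := mulr_ge0 (ltW al_gt0) (energy_ge0 a D (x - c *: net_point f)).
  set e := energy _ _ _; set q := sqnorm _ => e0 q0 h; split; first by lra.
  by rewrite -ler_pdivrMr ?mulr_gt0// mulrC; move: h; rewrite -/al; lra.
set r := l1norm x.
have r_ge0 : 0 <= r by apply: sumr_ge0 => j _; exact: normr_ge0.
have [r0|rn0] := eqVneq r 0.
  exists [ffun=> (Ordinal d_gt0, false)], 0.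
  have -> : x = 0.
    apply/colP => j; rewrite mxE; apply/eqP; rewrite -normr_eq0; apply/eqP.
    by move/psumr_eq0P: r0; apply=> // i _; exact: normr_ge0.
  rewrite scale0r subr0 -(scale0r (0 : 'cV[R]_d)) formZ expr0n mul0r.
  by rewrite mulr_ge0 ?divr_ge0 ?sqr_ge0.
pose p j := `|x j 0| / r.
pose v j : 'cV[R]_d := (r * (-1) ^+ (x j 0 < 0)%R) *: delta_mx j 0.
have p0 j : 0 <= p j by rewrite divr_ge0.
have p1 : \sum_j p j = 1 by rewrite -mulr_suml divff.
have xE : \sum_j p j *: v j = x.
  apply/colP => i; rewrite summxE (bigD1 i)//= big1 => [|j ji]; last first.
    by rewrite !mxE eq_sym (negbTE ji) !mulr0.
  by rewrite addr0 !mxE !eqxx mulr1 mulrA divfK// [LHS]mulrC -numEsign.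
have vL j : form (v j) (v j) <= 2 * r ^+ 2.
  by rewrite formZ exprMn sqrr_sign mulr1 mulrC ler_wpM2r ?sqr_ge0.
have [f] := maurey form_linear form_sym form_ge0 p0 p1 vL k.
rewrite xE => fP.
(* The average of the chosen [v (f i)] is this multiple of a net point. *)
exists [ffun i => (f i, x (f i) 0 < 0)], (r / k%:R).
set z := net_point _; have kn0 : k%:R != 0 :> R by rewrite gt_eqF.
have SE : \sum_(i < k) (v (f i) - x) = r *: z - k%:R *: x.
  rewrite sumrB sumr_const card_ord scaler_nat; congr (_ - _).
  rewrite /z /net_point scaler_sumr; apply: eq_bigr => i _.
  by rewrite ffunE /= scalerA.
have -> : x - (r / k%:R) *: z = (- k%:R^-1) *: \sum_(i < k) (v (f i) - x).
  rewrite SE scalerBr !scalerA !mulNr mulVf// scaleN1r opprK addrC scaleNr.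
  by rewrite [r / _]mulrC.
rewrite formZ sqrrN exprVn.
rewrite ler_pdivrMl ?exprn_gt0//; apply: le_trans fP _.
by rewrite le_eqVlt; apply/orP; left; apply/eqP; field.
Qed.

Let sqnorm_split x y : sqnorm x <= 2 * sqnorm y + 2 * sqnorm (x - y).
Proof.
rewrite /sqnorm !mulr_sumr -big_split; apply: ler_sum => j _ /=; rewrite !mxE.
by have := sqr_ge0 (x j 0 - 2 * y j 0); nra.
Qed.

Let energy_split x y : energy a D x <= 2 * energy a D y + 2 * energy a D (x - y).
Proof.
rewrite /energy !mulr_sumr -big_split; apply: ler_sum => r _ /=.
have -> : \sum_j a r j * (x - y) j 0 = \sum_j a r j * x j 0 - \sum_j a r j * y j 0.
  by rewrite -sumrB; apply: eq_bigr => j _; rewrite !mxE mulrBr.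
set b := \sum_j a r j * x j 0; set c := \sum_j a r j * y j 0.
by have := sqr_ge0 (b - 2 * c); nra.
Qed.

Let sqnormN x : sqnorm (- x) = sqnorm x.
Proof. by rewrite -scaleN1r sqnormZ sqrrN expr1n mul1r. Qed.

Let energyN x : energy a D (- x) = energy a D x.
Proof. by rewrite -scaleN1r energyZ sqrrN expr1n mul1r. Qed.

(** Split [x] into [z] and an error, for both norms. The lower bound halves the initial 1/4 twice,
    whence 1/16. The upper bound comes out as [C] times [4 * sqnorm x] plus 12 times the correction,
    whence [12 * C]; the summand 1 covers a remaining 1/4 in the lower bound. *)
Lemma energy_bounds x :
  #|D|%:R * (sqnorm x / 16 - (12 * C + 1) * (l1norm x ^+ 2 / k%:R)) <= energy a D x
    <= (12 * C + 1) * #|D|%:R * (sqnorm x + l1norm x ^+ 2 / k%:R).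
Proof.
have [f [c [sq en]]] := sparse_approximation x.
set z := c *: net_point f in sq en.
have /andP[lo up] : #|D|%:R / 4 * sqnorm z <= energy a D z <= C * #|D|%:R * sqnorm z.
  rewrite /z sqnormZ energyZ; have /andP[lo up] := wc f.
  by rewrite 2!(mulrCA _ (c ^+ 2)) !ler_wpM2l ?sqr_ge0.
have h1 := sqnorm_split x z; have h2 := sqnorm_split z x.
have h3 := energy_split x z; have h4 := energy_split z x.
rewrite -[z - x]opprB sqnormN in h2; rewrite -[z - x]opprB energyN in h4.
have rho0 : 0 <= l1norm x ^+ 2 / k%:R by rewrite divr_ge0 ?sqr_ge0.
move: sq en lo up h1 h2 h3 h4 rho0; set rho := l1norm x ^+ 2 / _; set N : R := #|D|%:R.
set sx := sqnorm x; set sz := sqnorm z; set sd := sqnorm _.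
set ex := energy a D x; set ez := energy a D z; set ed := energy _ _ _.
move=> sq en lo up h1 h2 h3 h4 rho0.
have N0 : 0 < N by rewrite /N ltr0n.
have CN0 : 0 < C * N by exact: mulr_gt0.
have sx0 : 0 <= sx := sqnorm_ge0 x.
apply/andP; split.
  have : N * sx <= N * (2 * sz + 4 * rho) by rewrite ler_wpM2l ?(ltW N0)//; lra.
  have : 0 <= N * rho by rewrite mulr_ge0 ?(ltW N0).
  have : 0 <= C * N * rho by rewrite mulr_ge0 ?(ltW CN0).
  by move: en lo h4; lra.
have : C * N * sz <= C * N * (2 * sx + 4 * rho).
  by rewrite ler_wpM2l ?(ltW CN0)//; lra.
have : 0 <= N * sx by rewrite mulr_ge0 ?(ltW N0).
have : 0 <= C * N * sx by rewrite mulr_ge0 ?(ltW CN0).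
have : 0 <= N * rho by rewrite mulr_ge0 ?(ltW N0).
have : 0 <= C * N * rho by rewrite mulr_ge0 ?(ltW CN0).
by move: en up h3; lra.
Qed.

End QuadraticBounds.

(** * Deterministic recovery *)

Section GraphDistance.
Variables (V : finType) (e : rel V).
Hypothesis conn : connected_graph e.

(** A path without repetitions has fewer than [#|V|] edges, so the search in [gdist] succeeds and
    its default value is not taken. *)
Lemma gdist_path (v w : V) : exists p : seq V,
  [/\ path e v p, last v p = w & size p = gdist e v w].
Proof.
pose reach k := [exists p : k.-tuple V, path e v p && (last v p == w)].
have hasr : has reach (iota 0 #|V|).
  have /connectP[p ep lp] := conn v w.
  case/shortenP: ep lp => p' ep' up' _ lp'.
  apply/hasP; exists (size p').
    rewrite mem_iota add0n /=; have := max_card [in v :: p'].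
    by rewrite (card_uniqP up').
  by apply/existsP; exists (in_tuple p'); rewrite ep' /= lp'.
have fl : (find reach (iota 0 #|V|) < #|V|)%N.
  by have := hasr; rewrite has_find size_iota.
have := nth_find 0%N hasr; rewrite nth_iota// add0n.
move=> /existsP[p /andP[ep /eqP lp]].
by exists p; rewrite size_tuple.
Qed.

Lemma gdist_le_diam (v w : V) : (gdist e v w <= diam e)%N.
Proof.
apply: leq_trans (leq_bigmax v); exact: (leq_bigmax (F := fun w => gdist e v w) w).
Qed.

End GraphDistance.

Section Supports.
Context {R : realType} (d : nat).
Implicit Types x y z : 'cV[R]_d.

Lemma Supp_subD x y z : Supp (x - z) \subset (Supp (x - y) :|: Supp (y - z))%SET.
Proof.
apply/fintype.subsetP => i; rewrite !inE !mxE; apply: contraR.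
rewrite negb_or !negbK !subr_eq0 => /andP[/eqP-> /eqP->]; exact: eqxx.
Qed.

Lemma card_Supp_path n (e : rel 'I_n) (s' : nat) (x : 'I_n -> 'cV[R]_d) v p :
  (forall v w, e v w -> (#|Supp (x v - x w)| <= s')%N) -> path e v p ->
  (#|Supp (x v - x (last v p))| <= size p * s')%N.
Proof.
move=> es; elim: p v => [|w p ih] v /=.
  move=> _; rewrite mul0n leqn0 cards_eq0; apply/eqP/setP => i.
  by rewrite !inE !mxE subrr eqxx.
move=> /andP[evw ewp]; apply: leq_trans (subset_leq_card (Supp_subD _ (x w) _)) _.
apply: leq_trans (leq_card_setU _ _) _; rewrite mulSn leq_add ?es//.
exact: ih.
Qed.

(** Differences telescope along a shortest walk to the root, and each edge adds at most [s']
    indices. *)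
Lemma card_Supp_diam n (root : 'I_n) (e : rel 'I_n) (s s' : nat)
    (x : 'I_n -> 'cV[R]_d) v :
  connected_graph e -> sparse_signals root e s s' x ->
  (#|Supp (x v - x root)| <= diam e * s')%N.
Proof.
move=> conn [_ es]; have [p [ep lp sp]] := gdist_path conn v root.
rewrite -lp; apply: leq_trans (card_Supp_path es ep) _.
by rewrite sp leq_mul2r gdist_le_diam orbT.
Qed.

Definition l1on (S : {set 'I_d}) x : R := \sum_(i in S) `|x i 0|.

Lemma l1norm_ge0 x : 0 <= l1norm x.
Proof. by apply: sumr_ge0 => i _; exact: normr_ge0. Qed.

Lemma l1norm_eq0 x : l1norm x = 0 -> x = 0.
Proof.
move=> x0; apply/colP => i; rewrite mxE; apply/eqP; rewrite -normr_eq0; apply/eqP.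
by move/psumr_eq0P: x0; apply=> // j _; exact: normr_ge0.
Qed.

Lemma l1on_card0 (S : {set 'I_d}) x : #|S| = 0%N -> l1on S x = 0.
Proof. by move/cards0_eq ->; rewrite /l1on big_set0. Qed.

(** Off the support of [x] the norms add exactly; on it, at most twice the mass of [h] is lost. *)
Lemma l1norm_perturb x h :
  l1norm x + l1norm h - 2 * l1on (Supp x) h <= l1norm (x + h).
Proof.
rewrite /l1norm /l1on mulr_sumr (big_mkcond [in Supp x]) /= -big_split /= -sumrB.
apply: ler_sum => i _; rewrite !mxE inE.
have [->|_] /= := eqVneq (x i 0) 0; first by rewrite normr0 !add0r subr0.
have := ler_normD (x i 0 + h i 0) (- h i 0); rewrite addrK normrN.
by lra.
Qed.

End Supports.

Section Recovery.
Context {R : realType} (n d : nat) (root : 'I_n) (N : 'I_n -> nat).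
Variables (A : forall v, 'M[R]_(N v, d)) (xs : 'I_n -> 'cV[R]_d).
Hypothesis root0 : root = 0%N :> nat.

(** The root has the least index, so in the enumeration by increasing pairs each star edge occurs
    once, with the root first. *)
Lemma tv_objective_star (x : 'I_n -> 'cV[R]_d) :
  tv_objective root (star root) x =
  l1norm (x root) + \sum_(v | v != root) l1norm (x v - x root).
Proof.
have l1N (y : 'cV[R]_d) : l1norm (- y) = l1norm y.
  by apply: eq_bigr => i _; rewrite mxE normrN.
rewrite /tv_objective; congr (_ + _).
rewrite -(pair_big_dep xpredT (fun u v : 'I_n => (u < v)%N && star root u v)
  (fun u v => l1norm (x u - x v))) /=.
rewrite (bigD1 root)//= [X in _ + X]big1 ?addr0 => [|u uroot].
  apply: eq_big => [v|v _]; last by rewrite -l1N opprB.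
  rewrite /star eqxx /= andbT [root == v]eq_sym andb_idl// => vr.
  by rewrite root0 lt0n -root0.
apply: big1 => v /andP[uv /andP[_]]; rewrite (negbTE uroot) /= => /eqP vE.
by move: uv; rewrite vE root0.
Qed.

Let Sv v := Supp (xs v - xs root).

Hypothesis root_nsp : forall u, A root *m u = 0 ->
  l1on (Supp (xs root)) u <= l1norm u / 4.
Hypothesis nonroot_nsp : forall u (h : 'I_n -> 'cV[R]_d),
  A root *m u = 0 -> (forall v, v != root -> A v *m h v = 0) ->
  \sum_(v | v != root) (2 * l1on (Sv v) (h v - u) - 3 / 4 * l1norm (h v - u))
    <= l1norm u / 4.

(** The root term gains at least half of [l1norm u]. The edges gain a quarter of their norms, up to
    a total defect of at most [l1norm u / 4]. Thus single edges may lose, the root paying for them,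
    and a quarter of every norm survives, which also forces uniqueness. *)
Lemma tv_objective_gap x : tvbp_feasible A (fun v => A v *m xs v) x ->
  tv_objective root (star root) xs + l1norm (x root - xs root) / 4 +
    (\sum_(v | v != root) l1norm ((x v - xs v) - (x root - xs root))) / 4
    <= tv_objective root (star root) x.
Proof.
move=> fx; pose h v := x v - xs v; pose u := h root.
have Ah v : A v *m h v = 0 by rewrite mulmxBr fx subrr.
rewrite !tv_objective_star -/(h root) -/u.
have h1 := l1norm_perturb (xs root) u.
rewrite [xs root + _]addrC subrK in h1.
have h2 : \sum_(v | v != root) (l1norm (xs v - xs root) + l1norm (h v - u) -
    2 * l1on (Sv v) (h v - u)) <= \sum_(v | v != root) l1norm (x v - x root).
  apply: ler_sum => v _; apply: le_trans (l1norm_perturb _ _) _.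
  rewrite le_eqVlt; apply/orP; left; apply/eqP; congr l1norm.
  by apply/colP => i; rewrite !mxE; ring.
have h3 := root_nsp (Ah root); have h4 := nonroot_nsp (Ah root) (fun v _ => Ah v).
move: h2 h4; rewrite sumrB big_split /= sumrB -!mulr_sumr.
rewrite -/u; set a := \sum_(v | _) l1norm (xs v - _).
set b := \sum_(v | _) l1norm (h v - u); set c := \sum_(v | _) l1on _ _.
by move: h1 h3; rewrite -/u; lra.
Qed.

Lemma tvbp_recovery :
  (exists! x, tvbp_solution root (star root) A (fun v => A v *m xs v) x) /\
  (forall x, tvbp_solution root (star root) A (fun v => A v *m xs v) x ->
     forall v, x v = xs v).
Proof.
have sum_ge0 x : 0 <= \sum_(v | v != root) l1norm ((x v - xs v) - (x root - xs root)).
  by apply: sumr_ge0 => v _; exact: l1norm_ge0.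
have solxs : tvbp_solution root (star root) A (fun v => A v *m xs v) xs.
  split=> // x /tv_objective_gap; have := sum_ge0 x.
  by have := l1norm_ge0 (x root - xs root); lra.
have uniq_sol x : tvbp_solution root (star root) A (fun v => A v *m xs v) x ->
    forall v, x v = xs v.
  move=> [fx minx]; have := minx xs solxs.1; have := tv_objective_gap fx.
  have s0 := sum_ge0 x; have u0 := l1norm_ge0 (x root - xs root) => h1 h2.
  have ru : x root - xs root = 0 by apply: l1norm_eq0; lra.
  have rs : \sum_(v | v != root) l1norm ((x v - xs v) - (x root - xs root)) = 0 by lra.
  move=> v; have [->|vr] := eqVneq v root; first exact/eqP/(etrans (esym (subr_eq0 _ _)))/eqP.
  have /psumr_eq0P/(_ v vr) := rs; move=> /(_ (fun _ _ => l1norm_ge0 _)).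
  by move=> /l1norm_eq0/eqP; rewrite ru subr0 subr_eq0 => /eqP.
split=> //; exists xs; split=> // x /uniq_sol xE.
by apply/funext => v; rewrite xE.
Qed.

End Recovery.

(** * Null space inequalities from energy bounds *)

Section NullSpaceEstimates.
Context {R : realType}.

Lemma sqr_sum_le (I : finType) (Q : {pred I}) (f : I -> R) :
  (\sum_(i in Q) f i) ^+ 2 <= #|Q|%:R * \sum_(i in Q) f i ^+ 2.
Proof.
set S2 := \sum_(i in Q) f i ^+ 2.
have E : #|Q|%:R * S2 = \sum_(i in Q) \sum_(j in Q) (f i ^+ 2 + f j ^+ 2) / 2.
  under eq_bigr do rewrite -mulr_suml big_split /= sumr_const -/S2.
  rewrite -mulr_suml big_split /= sumr_const -sumrMnl -/S2 -mulr_natl.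
  by rewrite sumrMnl -/S2 -mulr_natl; field.
rewrite E expr2 mulr_suml; apply: ler_sum => i _; rewrite mulr_sumr.
by apply: ler_sum => j _; have := sqr_ge0 (f i - f j); nra.
Qed.

Lemma l1on_sqr_le d (S : {set 'I_d}) (x : 'cV[R]_d) (s : nat) : (#|S| <= s)%N ->
  l1on S x ^+ 2 <= s%:R * sqnorm x.
Proof.
move=> Ss; apply: le_trans (sqr_sum_le _ _) _.
apply: ler_pM => //; first by apply: sumr_ge0 => i _; exact: sqr_ge0.
  by rewrite ler_nat.
rewrite /sqnorm big_mkcond; apply: ler_sum => i _.
by rewrite real_normK ?num_real//; case: ifP => // _; exact: sqr_ge0.
Qed.

Lemma sqnorm_kernel_le d (K k Nr : R) (x : 'cV[R]_d) : 0 < Nr ->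
  Nr * (sqnorm x / 16 - K * (l1norm x ^+ 2 / k)) <= 0 ->
  sqnorm x <= 16 * K * (l1norm x ^+ 2 / k).
Proof. by move=> N0; rewrite pmulr_rle0//; lra. Qed.

(** The bound gives [sqnorm u <= 16 * K * (l1norm u ^+ 2 / k)], and Cauchy-Schwarz on [S] adds a
    factor [s]; 256 = 16 * 16 leaves the square of [l1norm u / 4]. *)
Lemma root_nsp_of_bound d (S : {set 'I_d}) (s : nat) (K k Nr : R) (u : 'cV[R]_d) :
  (#|S| <= s)%N -> 0 < Nr -> 0 < k -> 256 * K * s%:R <= k ->
  Nr * (sqnorm u / 16 - K * (l1norm u ^+ 2 / k)) <= 0 ->
  l1on S u <= l1norm u / 4.
Proof.
move=> Ss N0 k0 kK /(sqnorm_kernel_le N0) su.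
have := l1on_sqr_le u Ss.
have on0 : 0 <= l1on S u by apply: sumr_ge0 => i _; exact: normr_ge0.
move=> h; rewrite -ler_sqr ?nnegrE ?divr_ge0 ?l1norm_ge0//.
apply: (le_trans h); apply: (@le_trans _ _ (s%:R * (16 * K * (l1norm u ^+ 2 / k)))).
  by rewrite ler_wpM2l.
have -> : s%:R * (16 * K * (l1norm u ^+ 2 / k)) =
   (256 * K * s%:R) * (l1norm u ^+ 2 / (16 * k)) by field; rewrite gt_eqF.
have -> : (l1norm u / 4) ^+ 2 = k * (l1norm u ^+ 2 / (16 * k)).
  by field; rewrite gt_eqF.
by rewrite ler_wpM2r// divr_ge0 ?sqr_ge0// mulr_ge0 ?ltW.
Qed.

(** [en v] models the energy of the rows of node [v]; [kv], [kB] and [kr] are the levels for one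
    node, for the block of all non-root rows, and for the root. *)
Variables (n d : nat) (root : 'I_n) (en : 'I_n -> 'cV[R]_d -> R).
Variables (Sv : 'I_n -> {set 'I_d}) (s2 : nat) (K N0 kv kB kr Nr : R).
Hypotheses (K_ge1 : 1 <= K) (N0_gt0 : 0 < N0) (Nr_gt0 : 0 < Nr).
Hypotheses (kv_gt0 : 0 < kv) (kB_gt0 : 0 < kB) (kr_gt0 : 0 < kr).
Hypothesis card_Sv : forall v, (#|Sv v| <= s2)%N.
Hypothesis kv_ge : 256 * K * s2%:R <= kv.
Hypothesis kB_ge : 2 ^+ 16 * K ^+ 2 * (n ^ 2 * s2)%:R <= kB.
Hypothesis kr_ge : 2 ^+ 16 * K ^+ 2 * (n ^ 2 * s2)%:R <= kr.
Hypothesis en_ge0 : forall v x, 0 <= en v x.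
Hypothesis en_lower : forall v x, v != root ->
  N0 * (sqnorm x / 16 - K * (l1norm x ^+ 2 / kv)) <= en v x.
Hypothesis en_upper : forall x, \sum_(v | v != root) en v x <=
  K * (n%:R * N0) * (sqnorm x + l1norm x ^+ 2 / kB).

(** If the defect is positive, [l1norm g] is at most 8/3 of its part on [Sv v], so the correction
    costs at most half of [sqnorm g / 16]. Then [sqnorm g] is at most [32 * en v g / N0], and 128 =
    4 * 32. *)
Lemma edge_defect_le v g : v != root ->
  Num.max 0 (2 * l1on (Sv v) g - 3 / 4 * l1norm g) ^+ 2 <=
    128 * s2%:R * (en v g / N0).
Proof.
move=> vr; have h := l1on_sqr_le g (card_Sv v).
have g0 := l1norm_ge0 g.
have on0 : 0 <= l1on (Sv v) g by apply: sumr_ge0 => i _; exact: normr_ge0.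
have RHS0 : 0 <= 128 * s2%:R * (en v g / N0).
  by apply: mulr_ge0; [exact: mulr_ge0|rewrite divr_ge0// ltW].
have [cmp|cmp] := lerP (2 * l1on (Sv v) g) (3 / 4 * l1norm g).
  by rewrite max_l ?subr_le0// expr0n.
rewrite max_r ?subr_ge0 ?(ltW cmp)//.
set q := sqnorm g in h; have q0 : 0 <= q by exact: sqnorm_ge0.
have l1q : l1norm g ^+ 2 <= 64 / 9 * (s2%:R * q).
  by apply: (@le_trans _ _ (64 / 9 * l1on (Sv v) g ^+ 2)); nra.
have l1k : K * (l1norm g ^+ 2 / kv) <= q / 32.
  rewrite mulrA ler_pdivrMr//.
  apply: (@le_trans _ _ (K * (64 / 9 * (s2%:R * q)))).
    by rewrite ler_wpM2l// (le_trans _ K_ge1).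
  have : 256 * K * s2%:R * q <= kv * q by rewrite ler_wpM2r.
  have : 0 <= K * s2%:R * q by rewrite !mulr_ge0// (le_trans _ K_ge1).
  by lra.
have lowq : q / 32 <= en v g / N0.
  rewrite ler_pdivlMr// mulrC; apply: le_trans (en_lower g vr).
  by rewrite ler_wpM2l ?(ltW N0_gt0)// -/q; lra.
have : s2%:R * (q / 32) <= s2%:R * (en v g / N0) by rewrite ler_wpM2l.
have : (2 * l1on (Sv v) g - 3 / 4 * l1norm g) ^+ 2 <= 4 * l1on (Sv v) g ^+ 2.
  by nra.
by lra.
Qed.

(** Positive parts are taken before squaring. Each node's energy is moved from [g v] to the common
    vector [u] before summation, which makes the block bound applicable. Its two terms may each use
    [l1norm u ^+ 2 / 32]; the first one needs 2^16 = 128 * 16 * 32, with one factor [K] from the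
    block and one from the root. *)
Lemma nonroot_nsp_of_bounds (u : 'cV[R]_d) (g : 'I_n -> 'cV[R]_d) :
  (forall v, v != root -> en v (g v) = en v u) ->
  Nr * (sqnorm u / 16 - K * (l1norm u ^+ 2 / kr)) <= 0 ->
  \sum_(v | v != root) (2 * l1on (Sv v) (g v) - 3 / 4 * l1norm (g v))
    <= l1norm u / 4.
Proof.
move=> eng /(sqnorm_kernel_le Nr_gt0) su.
pose t v := Num.max 0 (2 * l1on (Sv v) (g v) - 3 / 4 * l1norm (g v)).
apply: (@le_trans _ _ (\sum_(v | v != root) t v)).
  by apply: ler_sum => v _; rewrite le_max lexx orbT.
have t0 : 0 <= \sum_(v | v != root) t v.
  by apply: sumr_ge0 => v _; rewrite le_max lexx.
rewrite -ler_sqr ?nnegrE ?divr_ge0 ?l1norm_ge0//.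
apply: (le_trans (sqr_sum_le [pred v | v != root] t)).
apply: (@le_trans _ _ (n%:R * (128 * s2%:R * (\sum_(v | v != root) en v u / N0)))).
  apply: ler_pM => //; first by apply: sumr_ge0 => v _; exact: sqr_ge0.
    by rewrite ler_nat -[X in (_ <= X)%N](card_ord n) max_card.
  rewrite mulr_sumr; apply: ler_sum => v vr; rewrite -(eng v vr).
  exact: edge_defect_le.
rewrite -mulr_suml.
have h : (\sum_(v | v != root) en v u) / N0 <=
    K * n%:R * (sqnorm u + l1norm u ^+ 2 / kB).
  rewrite ler_pdivrMr//; apply: le_trans (en_upper u) _.
  by rewrite le_eqVlt; apply/orP; left; apply/eqP; ring.
set r2 := l1norm u ^+ 2 in su h *; have r20 : 0 <= r2 by exact: sqr_ge0.
have K0 : 0 <= K by apply: le_trans K_ge1.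
pose m : R := (n ^ 2 * s2)%:R; have m0 : 0 <= m by [].
apply: (@le_trans _ _ (128 * m * K * (16 * K * (r2 / kr) + r2 / kB))).
  apply: (@le_trans _ _ (n%:R * (128 * s2%:R * (K * n%:R * (sqnorm u + r2 / kB))))).
    by rewrite ler_wpM2l// ler_wpM2l// mulr_ge0.
  have -> : n%:R * (128 * s2%:R * (K * n%:R * (sqnorm u + r2 / kB))) =
    128 * m * K * (sqnorm u + r2 / kB) by rewrite /m natrM natrX; ring.
  by rewrite ler_wpM2l ?lerD2r// !mulr_ge0.
have -> : (l1norm u / 4) ^+ 2 = r2 / 32 + r2 / 32 by rewrite /r2; field.
rewrite mulrDr lerD//.
  rewrite (_ : _ * _ = 2 ^+ 11 * K ^+ 2 * m * r2 / kr); last by field; rewrite gt_eqF.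
  rewrite ler_pdivrMr// mulrAC.
  have : 2 ^+ 16 * K ^+ 2 * m * r2 <= kr * r2 by rewrite ler_wpM2r.
  by rewrite !exprS !expr0; lra.
rewrite mulrA ler_pdivrMr//.
have h1 : 2 ^+ 16 * K ^+ 2 * m * r2 <= kB * r2 by rewrite ler_wpM2r.
have h3 : 0 <= K * m * r2 by apply: mulr_ge0 => //; exact: mulr_ge0.
have h2 : K * m * r2 <= K ^+ 2 * m * r2.
  have -> : K ^+ 2 * m * r2 = K * (K * m * r2) by ring.
  exact: ler_peMl.
by move: h1 h2 h3; rewrite !exprS !expr0; lra.
Qed.

End NullSpaceEstimates.

(** * Sample sizes *)

Section EnergyEvents.
Context {dT : measure_display} {T : measurableType dT} {R : realType}.
Variables (P : probability T R) (Ro : finType) (d : nat).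
Variable X : Ro * 'I_d -> {RV P >-> R}.
Hypothesis indepX : mutually_independent X.
Variables (mu M : R).
Hypotheses (mu_gt0 : 0 < mu) (M_ge0 : 0 <= M).
Hypothesis meanX : forall i, (\int[P]_w (X i w)%:E = 0)%E.
Hypothesis varX : forall i, (\int[P]_w (X i w ^+ 2)%:E = 1)%E.
Hypothesis expX : forall i, (\int[P]_w (expR (mu * X i w ^+ 2))%:E <= M%:E)%E.
Variables (D : {set Ro}) (k : nat).
Hypotheses (d_gt0 : (0 < d)%N) (D_gt0 : (0 < #|D|)%N) (k_gt0 : (0 < k)%N).

Let C1 := energy_const mu M.
Let C1_gt0 : 0 < C1 := energy_const_gt0 mu_gt0 M_ge0.

(* In dimension one a single net direction suffices; the sharper bound matters
   there because the sample size may then be as small as 1. *)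
Definition failure_prob (c0 : R) (d' k' m : nat) : R :=
  if d' == 1%N then expR (- (c0 * m%:R))
  else ((2 * d') ^ k')%:R * (2 * expR (- (c0 * m%:R))).

Let e : 'cV[R]_d := const_mx 1.

Let e_sqnorm : d = 1%N -> sqnorm e = 1.
Proof.
move=> d1; rewrite /sqnorm (eq_bigr (fun=> 1)); last by move=> j _; rewrite mxE expr1n.
by rewrite sumr_const card_ord d1.
Qed.

Let multiple_of_e (x : 'cV[R]_d) : d = 1%N -> exists c, x = c *: e.
Proof.
move=> d1; exists (x (Ordinal d_gt0) 0); apply/colP => j; rewrite !mxE mulr1.
congr (x _ 0); apply/val_inj => /=.
by have := ltn_ord j; rewrite [in X in (_ < X)%N]d1; case: (nat_of_ord j).
Qed.

Let rho_ge0 (x : 'cV[R]_d) : 0 <= l1norm x ^+ 2 / k%:R.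
Proof. by rewrite divr_ge0 ?sqr_ge0. Qed.

(** Kept apart from the upper bound: the root and single nodes need only this one, the stacked rows
    only the other. In dimension one each then costs a single one-sided tail. *)
Lemma lower_event : exists B : set T, [/\ measurable B,
  (P B <= (failure_prob (conc_rate mu M) d k #|D|)%:E)%E &
  forall w, ~ B w -> forall x : 'cV[R]_d,
    #|D|%:R * (sqnorm x / 16 - (12 * C1 + 1) * (l1norm x ^+ 2 / k%:R)) <=
      random_energy X D x w].
Proof.
rewrite /failure_prob; case: eqP => [d1|_].
  exists [set w | random_energy X D e w <= #|D|%:R / 4]; split.
  - rewrite -[X in measurable X]setTI.
    apply: (@measurable_fun_le _ _ _ _ _ (cst _)) => //.
    exact: measurable_random_energy.
  - by apply: energy_lower_tail => //; exact: e_sqnorm.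
  move=> w /= /negP; rewrite -ltNge => /ltW ew x.
  have [c ->] := multiple_of_e x d1; rewrite /random_energy energyZ.
  rewrite sqnormZ e_sqnorm// mulr1.
  have h1 : c ^+ 2 * (#|D|%:R / 4) <=
      c ^+ 2 * energy (fun r j => X (r, j) w) D e by rewrite ler_wpM2l ?sqr_ge0.
  have h2 : 0 <= #|D|%:R * ((12 * C1 + 1) * (l1norm (c *: e) ^+ 2 / k%:R)).
    by rewrite mulr_ge0// mulr_ge0//; have := C1_gt0; lra.
  have h3 : 0 <= c ^+ 2 * #|D|%:R by rewrite mulr_ge0 ?sqr_ge0.
  by move: h1 h2 h3; lra.
have [B [mB PB wcB]] := well_conditioned_event indepX mu_gt0 M_ge0 meanX varX expX D k.
exists B; split=> //.
by move=> w /wcB wc x; have /andP[] := energy_bounds C1_gt0 d_gt0 D_gt0 k_gt0 wc x.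
Qed.

Lemma upper_event : exists B : set T, [/\ measurable B,
  (P B <= (failure_prob (conc_rate mu M) d k #|D|)%:E)%E &
  forall w, ~ B w -> forall x : 'cV[R]_d,
    random_energy X D x w <=
      (12 * C1 + 1) * #|D|%:R * (sqnorm x + l1norm x ^+ 2 / k%:R)].
Proof.
rewrite /failure_prob; case: eqP => [d1|_].
  exists [set w | C1 * #|D|%:R <= random_energy X D e w]; split.
  - rewrite -[X in measurable X]setTI.
    apply: (@measurable_fun_le _ _ _ _ (cst _)) => //.
    exact: measurable_random_energy.
  - by apply: energy_upper_tail => //; exact: e_sqnorm.
  move=> w /= /negP; rewrite -ltNge => /ltW ew x.
  have [c xE] := multiple_of_e x d1; have := rho_ge0 x; set rho := _ / _ => rho0.
  rewrite xE /random_energy energyZ sqnormZ e_sqnorm// mulr1.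
  have h1 : c ^+ 2 * energy (fun r j => X (r, j) w) D e <= c ^+ 2 * (C1 * #|D|%:R).
    by rewrite ler_wpM2l ?sqr_ge0.
  have h2 : 0 <= C1 * #|D|%:R * rho.
    by apply: mulr_ge0 => //; apply: mulr_ge0 => //; exact: ltW.
  have h3 : 0 <= #|D|%:R * rho by exact: mulr_ge0.
  have h4 : 0 <= c ^+ 2 * #|D|%:R by rewrite mulr_ge0 ?sqr_ge0.
  have h5 : 0 <= C1 * (c ^+ 2 * #|D|%:R) by rewrite mulr_ge0// ltW.
  by move: h1 h2 h3 h4 h5; lra.
have [B [mB PB wcB]] := well_conditioned_event indepX mu_gt0 M_ge0 meanX varX expX D k.
exists B; split=> //.
by move=> w /wcB wc x; have /andP[] := energy_bounds C1_gt0 d_gt0 D_gt0 k_gt0 wc x.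
Qed.

End EnergyEvents.

Section SampleSizes.
Context {R : realType}.
Variables (c0 : R) (M0 : nat).
Hypotheses (c0_gt0 : 0 < c0) (M0_gt0 : (0 < M0)%N).

Let rho : R := expR (- (c0 / 2)).
(** The inverse pushes [expR (- margin)] below [1 - rho]; the summand [c0 / 2] keeps it at most
    [rho], so the share of the root covers every dimension. *)
Definition margin : R := (1 - rho)^-1 + c0 / 2.
(** [ln d + L] is only known to be at least 1/2; the factor 2 makes up for it, so that
    [z * (ln d + L)] reaches [L + margin]. *)
Let z : R := 1 + 2 * margin.
(** For [1 < d], the prefactor [2 * (2 * d) ^ k] is at most [d ^ (3 * k)], whence [3 * M0]. The
    leading 2 pays for having [n - 1] instead of [n] blocks of rows, and for the [c0 / 2] at the
    root. *)
Definition sample_const : R := 2 * (3 * M0%:R + z) / c0.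

Let rho_lt1 : rho < 1.
Proof. by rewrite -expR0 ltr_expR oppr_lt0 divr_gt0. Qed.

Lemma margin_gt0 : 0 < margin.
Proof. by rewrite addr_gt0 ?divr_gt0// invr_gt0 subr_gt0. Qed.

Let a_ge0 : 0 <= 3 * M0%:R + z.
Proof. by rewrite addr_ge0// /z; have := margin_gt0; lra. Qed.

Lemma sample_const_gt0 : 0 < sample_const.
Proof.
rewrite divr_gt0// mulr_gt0// ltr_wpDl//.
by rewrite /z; have := margin_gt0; lra.
Qed.

Lemma failure_margin : expR (- (c0 / 2)) + expR (- margin) < 1.
Proof.
rewrite -ltrBrDl expRN -[ltRHS]invrK ltf_pV2 ?posrE ?invr_gt0 ?expR_gt0 ?subr_gt0//.
apply: lt_le_trans (expR_ge1Dx _).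
have : 0 < c0 / 2 by rewrite divr_gt0.
by rewrite /margin -/rho; lra.
Qed.

Lemma ln2_ge_half : 2^-1 <= ln 2 :> R.
Proof.
rewrite -ler_expR lnK ?posrE// -[leRHS]invrK -[leLHS]invrK -expRN.
rewrite lef_pV2 ?posrE ?expR_gt0 ?invr_gt0//.
by apply: le_trans (expR_ge1Dx _); lra.
Qed.

Lemma ln_nat_ge_half d : (1 < d)%N -> 2^-1 <= ln d%:R :> R.
Proof.
move=> d1; apply: le_trans ln2_ge_half _.
by rewrite ler_ln ?posrE ?ltr0n ?ler_nat// ltnW.
Qed.

Lemma failure_prob_le (d q m : nat) (L : R) : (0 < d)%N -> (0 < q)%N -> 0 <= L ->
  (1 < d)%N \/ 2^-1 <= L ->
  (3 * M0%:R + z) * q%:R * (ln d%:R + L) <= c0 * m%:R ->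
  failure_prob c0 d (M0 * q) m <= expR (- L) * expR (- margin).
Proof.
move=> d0 q0 L0 dL big; have y0 := margin_gt0.
have q1 : 1 <= q%:R :> R by rewrite ler1n.
have lnd0 : 0 <= ln d%:R :> R by rewrite ln_ge0// ler1n.
have half : 2^-1 <= ln d%:R + L.
  by case: dL => [/ln_nat_ge_half|]; lra.
have qz : ln d%:R + L <= q%:R * (ln d%:R + L) by rewrite ler_peMl//; lra.
have zq : z * (ln d%:R + L) <= z * (q%:R * (ln d%:R + L)).
  by rewrite ler_wpM2l// /z; lra.
have zL : L + margin <= z * (ln d%:R + L).
  have : margin * 2^-1 <= margin * (ln d%:R + L) by rewrite ler_wpM2l// ltW.
  by rewrite /z; lra.
have M0q : 0 <= M0%:R * (q%:R * L) by rewrite !mulr_ge0.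
rewrite -expRD /failure_prob; case: eqP => [d1|/eqP dn1].
  rewrite ler_expR.
  have : 0 <= M0%:R * (q%:R * (ln d%:R + L)) by rewrite !mulr_ge0// addr_ge0.
  by lra.
have d2 : (1 < d)%N by rewrite ltn_neqAle eq_sym dn1.
have dr0 : 0 < d%:R :> R by rewrite ltr0n.
have hd : d%:R = expR (ln d%:R) :> R by rewrite lnK ?posrE.
have h2 : 2 <= expR (ln d%:R) :> R by rewrite -hd ler_nat.
apply: (@le_trans _ _ (expR (2 * (M0%:R * q%:R) * ln d%:R) *
   (expR (ln d%:R) * expR (- (c0 * m%:R))))).
  apply: ler_pM; rewrite ?mulr_ge0 ?expR_ge0// ?ler_wpM2r ?expR_ge0//.
  rewrite [leRHS](_ : _ = (d%:R ^+ 2) ^+ (M0 * q)); last first.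
    by rewrite {2}hd -!expRM_natl natrM; congr expR; ring.
  rewrite natrX lerXn2r ?nnegrE ?exprn_ge0// -natrX ler_nat.
  by rewrite expnS expn1 leq_mul2r d2 orbT.
rewrite -!expRD ler_expR.
have h3 : ln d%:R <= (M0 * q)%:R * ln d%:R :> R.
  by rewrite ler_peMl// ler1n muln_gt0 M0_gt0.
move: h3 big zL zq M0q; rewrite natrM.
by lra.
Qed.

Lemma failure_prob_nonroot_le (d q m : nat) (L : R) :
  (0 < d)%N -> (0 < q)%N -> 2^-1 <= L ->
  sample_const * q%:R * (ln d%:R + L) <= 2 * m%:R ->
  failure_prob c0 d (M0 * q) m <= expR (- L) * expR (- margin).
Proof.
move=> d0 q0 L2 big; apply: failure_prob_le => //; [by lra|by right|].
have E : c0 * (sample_const * q%:R * (ln d%:R + L)) =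
    2 * ((3 * M0%:R + z) * q%:R * (ln d%:R + L)).
  by rewrite /sample_const; field; rewrite gt_eqF.
have : c0 * (sample_const * q%:R * (ln d%:R + L)) <= c0 * (2 * m%:R).
  by rewrite ler_wpM2l// ltW.
by rewrite E; lra.
Qed.

(** For [d = 1] the size condition is void at [L = 0]. Half of [c0 * m] supplies [L], and the other
    half is at least [c0 / 2] because [m] is positive. *)
Lemma failure_prob_root_le (d q m : nat) (L : R) :
  (0 < d)%N -> (0 < q)%N -> (0 < m)%N -> 0 <= L ->
  sample_const * q%:R * (ln d%:R + L) <= m%:R ->
  failure_prob c0 d (M0 * q) m <= expR (- L) * expR (- (c0 / 2)).
Proof.
move=> d0 q0 m0 L0 big.
have {}big : 2 * ((3 * M0%:R + z) * q%:R * (ln d%:R + L)) <= c0 * m%:R.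
  have -> : 2 * ((3 * M0%:R + z) * q%:R * (ln d%:R + L)) =
      c0 * (sample_const * q%:R * (ln d%:R + L)).
    by rewrite /sample_const; field; rewrite gt_eqF.
  by rewrite ler_wpM2l// ltW.
have lnd0 : 0 <= ln d%:R :> R by rewrite ln_ge0// ler1n.
have y0 := margin_gt0.
have b0 : 0 <= (3 * M0%:R + z) * q%:R * (ln d%:R + L).
  by rewrite !mulr_ge0// addr_ge0.
have [d1|d2] := eqVneq d 1%N; last first.
  apply: (@le_trans _ _ (expR (- L) * expR (- margin))).
    apply: failure_prob_le => //; last by lra.
    by left; rewrite ltn_neqAle eq_sym d2.
  rewrite ler_wpM2l ?expR_ge0// ler_expR lerN2 /margin lerDr invr_ge0.
  by rewrite subr_ge0 ltW.
rewrite /failure_prob d1 eqxx -expRD ler_expR.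
have m1 : c0 * 1 <= c0 * m%:R by rewrite ler_wpM2l ?(ltW c0_gt0)// ler1n.
have : L <= (3 * M0%:R + z) * q%:R * (ln d%:R + L).
  rewrite d1 ln1 add0r ler_peMl// mulr_ege1 ?ler1n//.
  have : 0 <= M0%:R :> R by [].
  by rewrite /z; lra.
by lra.
Qed.

End SampleSizes.

(** * The rows of all matrices as one family *)

Section StackedRows.
Context {dT : measure_display} {T : measurableType dT} {R : realType}.
Variable P : probability T R.

Lemma mutually_independent_inj (I K : finType) (X : K -> {RV P >-> R}) (f : I -> K) :
  injective f -> mutually_independent X -> mutually_independent (fun i => X (f i)).
Proof.
move=> injf indepX J B mB.
(* Variables outside the image of [f] stay unconstrained. *)
pose B' k := if [pick i | f i == k] is Some i then B i else setT.
have B'f i : B' (f i) = B i.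
  rewrite /B'; case: pickP => [j /eqP/injf->//|/(_ i)].
  by rewrite eqxx.
have mB' k : measurable (B' k) by rewrite /B'; case: pickP.
have := indepX (f @: J)%SET B' mB'.
rewrite big_imset/=; last by move=> i j _ _ /injf.
under eq_bigr do rewrite B'f.
move=> <-; congr (P _); apply/seteqP; split => w /= h.
  by move=> _ /imsetP[i iJ ->]; rewrite B'f; exact: h.
by move=> i iJ; rewrite -B'f; apply: h; exact: imset_f.
Qed.

Variables (n d : nat) (N : 'I_n -> nat).
Variable A : forall v : 'I_n, 'I_(N v) -> 'I_d -> {RV P >-> R}.

Let Ro : finType := {v : 'I_n & 'I_(N v)}.

Definition stacked_entry (k : Ro * 'I_d) : {RV P >-> R} := A (tagged k.1) k.2.

Definition node_rows (v : 'I_n) : {set Ro} := [set r | tag r == v]%SET.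
Definition other_rows (v : 'I_n) : {set Ro} := [set r | tag r != v]%SET.

Lemma stacked_entry_indep : independent_matrices A -> mutually_independent stacked_entry.
Proof.
move=> indA.
pose f (k : Ro * 'I_d) : {v : 'I_n & ('I_(N v) * 'I_d)%type} :=
  Tagged (fun v => ('I_(N v) * 'I_d)%type) (tagged k.1, k.2).
apply: (@mutually_independent_inj _ _ _ f _ indA).
move=> [[v i] j] [[v' i'] j'] /eqP; rewrite /f -tag_eqE /tag_eq /=.
case: eqP => //= vv'; case: v' / vv' i' => i'.
by rewrite tagged_asE => /eqP[-> ->].
Qed.

Lemma sum_node_rows (F : Ro -> nat) v :
  (\sum_(r in node_rows v) F r = \sum_(i < N v) F (Tagged _ i))%N.
Proof.
transitivity (\sum_(u | u == v) \sum_(i < N u) F (Tagged _ i))%N; last first.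
  by rewrite big_pred1_eq.
rewrite sig_big_dep /=; apply: eq_big => [[u i]|[u i] _] //=.
by rewrite inE andbT.
Qed.

Lemma card_node_rows v : #|node_rows v| = N v.
Proof. by rewrite -sum1_card sum_node_rows sum_nat_const card_ord muln1. Qed.

Lemma sum_other_rows (U : nmodType) (F : Ro -> U) v :
  \sum_(r in other_rows v) F r = \sum_(u | u != v) \sum_(r in node_rows u) F r.
Proof.
rewrite (partition_big (fun r : Ro => tag r) (fun u => u != v)) /=; last first.
  by move=> r; rewrite inE.
apply: eq_bigr => u uv; apply: eq_bigl => r; rewrite !inE.
by rewrite andb_idl// => /eqP->.
Qed.

Lemma card_other_rows v m : (forall u, u != v -> N u = m) ->
  #|other_rows v| = (n.-1 * m)%N.
Proof.
move=> Nm; rewrite -sum1_card; have := sum_other_rows (fun=> 1%N) v => ->.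
under eq_bigr => u uv do rewrite sum1_card card_node_rows Nm//.
by rewrite sum_nat_const cardC1 card_ord.
Qed.

Lemma node_rows_kernel v w (h : 'cV[R]_d) : (0 < N v)%N ->
  normalized_matrix (A (v := v)) w *m h = 0 ->
  forall r, r \in node_rows v -> \sum_j stacked_entry (r, j) w * h j 0 = 0.
Proof.
move=> Nv /colP Ah [u i]; rewrite inE /= => /eqP uv.
move: i; rewrite uv => i; have := Ah i; rewrite !mxE.
have -> : \sum_j normalized_matrix (A (v := v)) w i j * h j 0 =
    (Num.sqrt (N v)%:R)^-1 * \sum_j A i j w * h j 0.
  by rewrite mulr_sumr; apply: eq_bigr => j _; rewrite !mxE mulrA.
move=> /eqP; rewrite mulf_eq0 invr_eq0 sqrtr_eq0.
by rewrite lern0 gtn_eqF// => /eqP.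
Qed.

(** On these rows the images of [h - u] and [u] differ only by sign. *)
Lemma node_energy_kernel v w (h u : 'cV[R]_d) : (0 < N v)%N ->
  normalized_matrix (A (v := v)) w *m h = 0 ->
  random_energy stacked_entry (node_rows v) (h - u) w =
  random_energy stacked_entry (node_rows v) u w.
Proof.
move=> Nv Ah; apply: eq_bigr => r rv; rewrite -[RHS]sqrrN; congr (_ ^+ 2).
under eq_bigr do rewrite !mxE mulrBr.
by rewrite sumrB (node_rows_kernel Nv Ah rv) sub0r.
Qed.

Lemma node_energy0 v w (u : 'cV[R]_d) : (0 < N v)%N ->
  normalized_matrix (A (v := v)) w *m u = 0 ->
  random_energy stacked_entry (node_rows v) u w = 0.
Proof.
move=> Nv Au; rewrite -(node_energy_kernel u Nv Au) subrr.
rewrite /random_energy /energy big1// => r _; rewrite big1 ?expr0n// => j _.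
by rewrite mxE mulr0.
Qed.

End StackedRows.

Lemma subgaussian_moments {dT : measure_display} {T : measurableType dT}
    {R : realType} (P : probability T R) (beta kappa : R) (m d : nat)
    (A : 'I_m -> 'I_d -> {RV P >-> R}) : 0 < beta -> 0 < kappa ->
  iid_subgaussian beta kappa A -> forall i j,
  [/\ (\int[P]_w (A i j w)%:E = 0)%E, (\int[P]_w (A i j w ^+ 2)%:E = 1)%E &
    (\int[P]_w (expR (kappa / 4 * A i j w ^+ 2))%:E <=
      (expsqr_bound beta kappa)%:E)%E].
Proof.
move=> b0 k0 [_ _ mv tail] i j; have [m0 v1] := mv i j; split.
- by rewrite -expectation_def.
- rewrite -v1 /variance covariance.unlock m0 expectation.unlock.
  by apply: eq_integral => w _; rewrite -[in LHS](subr0 (A i j w)) expr2.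
- by apply: integral_expR_sqr_le; [|exact: ltW|exact: tail].
Qed.

(** * Assembly of the events and of the sample sizes *)

Theorem theorem1 (R : realType) (beta kappa : R)
    (beta_gt0 : 0 < beta) (kappa_gt0 : 0 < kappa) :
  exists C : R, 0 < C /\
  forall (n d : nat) (root : 'I_n) (e : rel 'I_n) (s s' : nat)
    (xstar : 'I_n -> 'cV[R]_d)
    (N : 'I_n -> nat) (Nnonroot : nat) (eps : R)
    (dT : measure_display) (T : measurableType dT) (P : probability T R)
    (Atilde : forall v : 'I_n, 'I_(N v) -> 'I_d -> {RV P >-> R}),
  root = 0%N :> nat ->
  (0 < d)%N ->
  symmetric e ->
  connected_graph e ->
  sparse_signals root e s s' xstar ->
  (forall v, (0 < N v)%N) ->
  (forall v, v != root -> N v = Nnonroot) ->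
  (forall v, iid_subgaussian beta kappa (Atilde v)) ->
  independent_matrices Atilde ->
  0 < eps ->
  C * (maxn s (n ^ 2 * diam e * s'))%:R * (ln d%:R + ln (1 / eps))
    <= (N root)%:R ->
  C * (n * diam e * s')%:R * (ln d%:R + ln (n%:R / eps)) <= Nnonroot%:R ->
  exists E : set T,
    [/\ measurable E,
        ((1 - eps)%:E < P E)%E &
        forall w, E w ->
          let A := fun v => normalized_matrix (Atilde v) w in
          let y := fun v => A v *m xstar v in
          (exists! x, tvbp_solution root (star root) A y x) /\
          (forall x, tvbp_solution root (star root) A y x ->
             forall v, x v = xstar v)].
Proof.
pose mu := kappa / 4; pose M := expsqr_bound beta kappa.
have mu_gt0 : 0 < mu by rewrite divr_gt0.
have M_ge0 : 0 <= M by rewrite ltW// expsqr_bound_gt0.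
pose C1 := energy_const mu M; have C1_gt0 : 0 < C1 by exact: energy_const_gt0.
pose K := 12 * C1 + 1; have K_ge1 : 1 <= K by rewrite /K; lra.
pose c0 := conc_rate mu M; have c0_gt0 : 0 < c0 by exact: conc_rate_gt0.
(* An integer above the ratio of level to sparsity demanded by [nonroot_nsp_of_bounds]; it also
   exceeds [256 * K]. *)
pose M0 := (Num.truncn (2 ^+ 16 * K ^+ 2)).+1; have M0_gt0 : (0 < M0)%N by [].
have M0_ge : 2 ^+ 16 * K ^+ 2 <= M0%:R.
  have /truncn_itv/andP[_ /ltW//] : 0 <= 2 ^+ 16 * K ^+ 2.
  by rewrite mulr_ge0 ?sqr_ge0// exprn_ge0.
exists (sample_const c0 M0); split; first exact: sample_const_gt0.
move=> n d root e s s' xs N Nnr eps dT T P A root0 d_gt0 _ conn sp N_gt0 Nv iid indA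
  eps_gt0 Nroot_ge Nnr_ge.
(* Above 1 the empty event will do. The value 1 stays in the main case, where [ln (1 / eps)] is
   nonnegative. *)
have [eps_gt1|eps_le1] := ltP 1 eps.
  by exists set0; split => //; rewrite measure0 lte_fin subr_lt0.
pose s2 := (diam e * s')%N; pose q := maxn s (n ^ 2 * s2).
have card_Sv v : (#|Supp (xs v - xs root)| <= s2)%N by exact: card_Supp_diam conn sp.
pose Sr := Supp (xs root); have card_Sr : (#|Sr| <= s)%N := sp.1.
pose X := stacked_entry A.
have indX : mutually_independent X := stacked_entry_indep indA.
have mom (k : {v : 'I_n & 'I_(N v)} * 'I_d) :=
    subgaussian_moments beta_gt0 kappa_gt0 (iid (tag k.1)) (tagged k.1) k.2.
have meanX k : (\int[P]_w (X k w)%:E = 0)%E by case: (mom k).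
have varX k : (\int[P]_w (X k w ^+ 2)%:E = 1)%E by case: (mom k).
have expX k : (\int[P]_w (expR (mu * X k w ^+ 2))%:E <= M%:E)%E by case: (mom k).
suff [B [mB PB goodB]] : exists B : set T, [/\ measurable B, (P B < eps%:E)%E &
    forall w, ~ B w ->
      (forall u, normalized_matrix (A root) w *m u = 0 ->
        l1on Sr u <= l1norm u / 4) /\
      (forall u (h : 'I_n -> 'cV[R]_d), normalized_matrix (A root) w *m u = 0 ->
        (forall v, v != root -> normalized_matrix (A v) w *m h v = 0) ->
        \sum_(v | v != root) (2 * l1on (Supp (xs v - xs root)) (h v - u) -
          3 / 4 * l1norm (h v - u)) <= l1norm u / 4)].
  exists (~` B); split; first exact: measurableC.
    rewrite probability_setC//; move: PB.
    have : P B \is a fin_num by rewrite fin_num_measure.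
    by case: (P B) => // r _; rewrite !lte_fin ltrD2l ltrN2.
  by move=> w /goodB[gr gn]; exact: tvbp_recovery.
have trivial_edges : s2 = 0%N \/ (forall v, v == root) ->
    forall u (h : 'I_n -> 'cV[R]_d),
    \sum_(v | v != root) (2 * l1on (Supp (xs v - xs root)) (h v - u) -
          3 / 4 * l1norm (h v - u)) <= l1norm u / 4.
  move=> triv u h; apply: (@le_trans _ _ 0); last by rewrite divr_ge0 ?l1norm_ge0.
  apply: sumr_le0 => v vr; case: triv => [s20|/(_ v)]; last by rewrite (negbTE vr).
  rewrite l1on_card0; last first.
    by apply/eqP; rewrite -leqn0; apply: leq_trans (card_Sv v) _; rewrite s20.
  by have := l1norm_ge0 (h v - u); lra.
have n_gt0 : (0 < n)%N by apply: leq_ltn_trans (ltn_ord root).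
(* If [q = 0], all supports involved are empty and both inequalities are trivial; the Maurey levels
   must be positive in what follows. *)
have [q0|q_gt0] := posnP q.
  have /eqP s0 : s == 0%N by have := leq_maxl s (n ^ 2 * s2); rewrite -/q q0 leqn0.
  have : (n ^ 2 * s2)%N == 0%N.
    by have := leq_maxr s (n ^ 2 * s2); rewrite -/q q0 leqn0.
  rewrite muln_eq0 expn_eq0 (gtn_eqF n_gt0) /= => /eqP s20.
  exists set0; split => //; first by rewrite measure0 lte_fin.
  move=> w _; split=> [u _|u h _ _]; last by apply: trivial_edges; left.
  rewrite l1on_card0 ?divr_ge0 ?l1norm_ge0//.
  by apply/eqP; rewrite -leqn0; apply: leq_trans card_Sr _; rewrite s0.
have qE : q = maxn s (n ^ 2 * diam e * s') by rewrite /q /s2 mulnA.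
have kr_gt0 : (0 < M0 * q)%N by rewrite muln_gt0 q_gt0.
have Dr_gt0 : (0 < #|node_rows N root|)%N by rewrite card_node_rows.
have [Br [mBr PBr goodBr]] :=
  lower_event indX mu_gt0 M_ge0 meanX varX expX d_gt0 Dr_gt0 kr_gt0.
pose rho : R := expR (- (c0 / 2)).
have L0 : 0 <= ln (1 / eps) by rewrite ln_ge0// mul1r invf_ge1.
have eL : expR (- ln (1 / eps)) = eps.
  by rewrite expRN lnK ?posrE ?divr_gt0// mul1r invrK.
have {}PBr : (P Br <= (eps * rho)%:E)%E.
  apply: (le_trans PBr); rewrite lee_fin card_node_rows -[X in X * rho]eL.
  by apply: failure_prob_root_le => //; rewrite qE.
have KM : 256 * K <= M0%:R by apply: le_trans M0_ge; rewrite !exprS !expr0; nra.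
have root_bound w u : ~ Br w -> normalized_matrix (A root) w *m u = 0 ->
    (N root)%:R * (sqnorm u / 16 - K * (l1norm u ^+ 2 / (M0 * q)%:R)) <= 0.
  move=> /goodBr/(_ u) h Au; move: h.
  by rewrite (node_energy0 (N_gt0 root) Au) card_node_rows.
have Nr_gt0 : 0 < (N root)%:R :> R by rewrite ltr0n.
have krR_gt0 : 0 < (M0 * q)%:R :> R by rewrite ltr0n.
have root_nsp w u : ~ Br w -> normalized_matrix (A root) w *m u = 0 ->
    l1on Sr u <= l1norm u / 4.
  move=> Bw Au; apply: (root_nsp_of_bound card_Sr Nr_gt0 krR_gt0 _ (root_bound w u Bw Au)).
  rewrite natrM; apply: ler_pM; [by lra|exact: ler0n|exact: KM|].
  by rewrite ler_nat leq_maxl.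
have rhoP : rho + expR (- margin c0) < 1 := failure_margin c0_gt0.
(* Here the root event is enough. For [s2 = 0] no lower bound on [Nnr] is available, and for a
   single node [ln (n / eps)] may be below 1/2. *)
have [triv|] := pselect (s2 = 0%N \/ (forall v, v == root)).
  exists Br; split=> //.
    apply: le_lt_trans PBr _; rewrite lte_fin gtr_pMr//.
    by have := expR_gt0 (- margin c0); lra.
  move=> w Bw; split=> [u|u h _ _]; first exact: root_nsp.
  exact: trivial_edges.
move=> /not_orP[/eqP]; rewrite -lt0n => s2_gt0 /existsNP[v0 /negP v0r].
have n_gt1 : (1 < n)%N.
  apply: leq_ltn_trans (ltn_ord v0); rewrite lt0n -root0.
  by apply: contra v0r => /eqP/val_inj/eqP.
have Nnr_gt0 : (0 < Nnr)%N by rewrite -(Nv v0).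
pose L := ln (n%:R / eps).
have nr_gt0 : 0 < n%:R :> R by rewrite ltr0n.
have L_ge : 2^-1 <= L.
  apply: le_trans (ln_nat_ge_half n_gt1) _.
  by rewrite ler_ln ?posrE ?divr_gt0// ler_peMr ?(ltW nr_gt0)// invf_ge1.
have eLn : expR (- L) = eps / n%:R.
  by rewrite expRN lnK ?posrE ?divr_gt0// invf_div.
pose delta := expR (- margin c0).
have lnd0 : 0 <= ln d%:R :> R by rewrite ln_ge0// ler1n.
have C_gt0 := sample_const_gt0 M0 c0_gt0.
have card_other : #|other_rows N root| = (n.-1 * Nnr)%N := card_other_rows Nv.
have n2 : (n <= 2 * n.-1)%N.
  by case: (n) n_gt1 => [|[|k]] //= _; rewrite mulSn mul1n addSn ltnS leq_addl.
have Nnr_ge' : sample_const c0 M0 * (n * s2)%:R * (ln d%:R + L) <= Nnr%:R.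
  by rewrite /s2 mulnA.
(* The index [root] carries the event of the stacked rows, so there are exactly [n] events, each
   with the share [eps / n * delta] that [ln (n / eps)] provides. *)
have bad_nodes v : exists B : set T, [/\ measurable B,
    (P B <= (eps / n%:R * delta)%:E)%E &
    forall w, ~ B w -> forall x : 'cV[R]_d,
      if v == root then
        random_energy X (other_rows N root) x w <=
          K * #|other_rows N root|%:R * (sqnorm x + l1norm x ^+ 2 / (M0 * (n ^ 2 * s2))%:R)
      else
        Nnr%:R * (sqnorm x / 16 - K * (l1norm x ^+ 2 / (M0 * s2)%:R)) <=
          random_energy X (node_rows N v) x w].
  have [vr|vr] := eqVneq v root.
    have kB_gt0 : (0 < M0 * (n ^ 2 * s2))%N by rewrite muln_gt0 M0_gt0 muln_gt0 expn_gt0 n_gt0.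
    have DB_gt0 : (0 < #|other_rows N root|)%N.
      by rewrite card_other muln_gt0 Nnr_gt0 andbT -ltnS prednK.
    have [B [mB PB goodB]] :=
      upper_event indX mu_gt0 M_ge0 meanX varX expX d_gt0 DB_gt0 kB_gt0.
    exists B; split=> //; apply: (le_trans PB); rewrite lee_fin -eLn.
    apply: failure_prob_nonroot_le => //; first by rewrite muln_gt0 expn_gt0 n_gt0.
    (* The stack has a level [n] times that of the hypothesis and about [n * Nnr] rows, so the
       hypothesis on one node is multiplied by [n]. *)
    apply: (@le_trans _ _ (n%:R * Nnr%:R)).
      have -> : sample_const c0 M0 * (n ^ 2 * s2)%:R * (ln d%:R + L) =
          n%:R * (sample_const c0 M0 * (n * s2)%:R * (ln d%:R + L)).
        by rewrite -mulnn -mulnA natrM; ring.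
      by rewrite ler_wpM2l.
    by rewrite card_other -!natrM ler_nat mulnA leq_mul2r n2 orbT.
  have kv_gt0 : (0 < M0 * s2)%N by rewrite muln_gt0.
  have Dv_gt0 : (0 < #|node_rows N v|)%N by rewrite card_node_rows.
  have [B [mB PB goodB]] :=
    lower_event indX mu_gt0 M_ge0 meanX varX expX d_gt0 Dv_gt0 kv_gt0.
  exists B; split=> //; last by move: goodB; rewrite card_node_rows Nv.
  apply: (le_trans PB); rewrite lee_fin -eLn card_node_rows Nv//.
  apply: failure_prob_nonroot_le => //.
  apply: (@le_trans _ _ (sample_const c0 M0 * (n * s2)%:R * (ln d%:R + L))).
    rewrite ler_wpM2r//; first by lra.
    by rewrite ler_wpM2l ?(ltW C_gt0)// ler_nat leq_pmull.
  by apply: (le_trans Nnr_ge'); rewrite ler_peMl// ler1n.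
have [Bn Bn_spec] := choice bad_nodes.
pose B := Br `|` \big[setU/set0]_(v <- enum 'I_n) Bn v.
have mBn : measurable (\big[setU/set0]_(v <- enum 'I_n) Bn v).
  by apply: bigsetU_measurable => v _; case: (Bn_spec v).
exists B; split; first exact: measurableU.
  apply: le_lt_trans (measureU2 _ _ _) _ => //.
  have PBn : (P (\big[setU/set0]_(v <- enum 'I_n) Bn v) <= (eps * delta)%:E)%E.
    apply: le_trans (@union_bound _ _ _ P _ _ Bn (fun=> eps / n%:R * delta) _ _) _.
    - by move=> v; case: (Bn_spec v).
    - by move=> v; case: (Bn_spec v).
    rewrite big_enum /= sumr_const card_ord -mulr_natl lee_fin.
    by rewrite le_eqVlt; apply/orP; left; apply/eqP; field; rewrite gt_eqF.
  (* The shares [rho] and [delta] sum to less than 1, which yields the strict inequality. *)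
  apply: (le_lt_trans (leeD PBr PBn)).
  by rewrite -EFinD lte_fin -mulrDr gtr_pMr.
move=> w Bw; have Brw : ~ Br w by move=> bw; apply: Bw; left.
have Bnw v : ~ Bn v w.
  move=> bw; apply: Bw; right; rewrite -bigcup_seq; exists v => //=.
  exact: mem_enum.
split=> [u|u h Au Ah]; first exact: root_nsp.
have good v x := let: And3 _ _ g := Bn_spec v in g w (Bnw v) x.
have Nnr_gt0' : 0 < Nnr%:R :> R by rewrite ltr0n.
have s2r : 0 < s2%:R :> R by rewrite ltr0n.
have K2_ge0 : 0 <= 2 ^+ 16 * K ^+ 2 by rewrite mulr_ge0 ?sqr_ge0// exprn_ge0.
apply: (nonroot_nsp_of_bounds (en := fun v x => random_energy X (node_rows N v) x w)
  (s2 := s2) (K := K) (N0 := Nnr%:R) (kv := (M0 * s2)%:R)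
  (kB := (M0 * (n ^ 2 * s2))%:R) (kr := (M0 * q)%:R) (Nr := (N root)%:R)) => //.
- by rewrite ltr0n muln_gt0.
- by rewrite ltr0n muln_gt0 M0_gt0 muln_gt0 expn_gt0 n_gt0.
- by rewrite natrM ler_wpM2r.
- by rewrite [leRHS]natrM ler_wpM2r.
- rewrite [leRHS]natrM; apply: ler_pM => //.
  by rewrite ler_nat leq_maxr.
- by move=> v x; exact: energy_ge0.
- by move=> v x vr; have := good v x; rewrite (negbTE vr).
- move=> x; have := good root x; rewrite eqxx /random_energy {1}/energy sum_other_rows.
  move=> h1; apply: (le_trans h1); rewrite ler_wpM2r//.
    by rewrite addr_ge0 ?sqnorm_ge0// divr_ge0 ?sqr_ge0.
  rewrite ler_wpM2l ?(le_trans _ K_ge1)// card_other natrM ler_wpM2r// ler_nat.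
  exact: leq_pred.
- by move=> v vr; apply: node_energy_kernel => //; exact: Ah.
exact: (root_bound _ _ Brw Au).
Qed.
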